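(* Let $\sigma$ be either the logistic function $\sigma(x)=\frac{1}{1+e^{-x}}$ or, for some $k\in\mathbb{N}$, the piecewise polynomial activation function $\sigma(x)=0$ for $x<0$, $\sigma(x)=x^k$ for $x\geq 0$. Let $r\in\mathbb{N}$, let $\Omega$ be the $d$-dimensional unit ball, $d\in\mathbb{N}$, and $1\leq p<\infty$. For each abstract modulus of smoothness $\omega$ satisfying $\lim_{\delta\to 0+}\frac{\omega(\delta)}{\delta}=\infty$, a counterexample $f_\omega\in L^p(\Omega)$ exists such that for $\delta\to 0+$ $$\omega_r(f_\omega,\delta)_{p,\Omega}=O(\omega(\delta^r))$$ and for $n\to\infty$ $$E(\mathcal{M}_n,f_\omega)_{p,\Omega}\neq o\left(\omega\left(\frac{1}{(n[1+\log_2(n)])^{\frac{r}{d}}}\right)\right).$$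
   Context: For an activation function $\sigma:\mathbb{R}\to\mathbb{R}$ and $n\in\mathbb{N}$, $\mathcal{M}_n=\mathcal{M}_{n,\sigma}:=\left\{\mathbf{x}\mapsto\sum_{j=1}^n a_j\sigma(\mathbf{w}_j\cdot\mathbf{x}+c_j): a_j,c_j\in\mathbb{R},\ \mathbf{w}_j\in\mathbb{R}^d\right\}$ (functions on $\mathbb{R}^d$), where $\cdot$ is the standard inner product. The unit ball is $\{\mathbf{x}\in\mathbb{R}^d:|\mathbf{x}|<1\}$. $E(S,f)_{p,\Omega}:=\inf\{\|f-g\|_{L^p(\Omega)}:g\in S\}$. An abstract modulus of smoothness is a continuous, increasing function $\omega:[0,\infty)\to[0,\infty)$ such that for all $\delta_1,\delta_2>0$: $0=\omega(0)<\omega(\delta_1)\leq\omega(\delta_1+\delta_2)\leq\omega(\delta_1)+\omega(\delta_2)$. For $\boldsymbol{\nu}\in\mathbb{R}^d$, let $\Delta_{\boldsymbol{\nu}}^r f(\mathbf{x}):=\sum_{j=0}^r(-1)^{r-j}\binom{r}{j}f(\mathbf{x}+j\boldsymbol{\nu})$ and $\Omega(\boldsymbol{\nu}):=\{\mathbf{x}\in\Omega:\mathbf{x}+t\boldsymbol{\nu}\in\Omega,\ 0\leq t\leq 1\}$. The $r$th radial modulus of smoothness of $f\in L^p(\Omega)$ is $\omega_r(f,\delta)_{p,\Omega}:=\sup\{\|\Delta_{\boldsymbol{\nu}}^r f\|_{L^p(\Omega(r\boldsymbol{\nu}))}:\boldsymbol{\nu}\in\mathbb{R}^d,\ |\boldsymbol{\nu}|\leq\delta\}$.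 $b_n\neq o(a_n)$ means $\limsup_{n\to\infty}b_n/a_n>0$ (for $b_n\geq 0$, $a_n>0$). *)

(* Defs.v *)
From HB Require Import structures.
From mathcomp Require Import all_boot all_order all_algebra.
From mathcomp Require Import all_classical all_reals all_analysis.

Set Implicit Arguments.
Unset Strict Implicit.
Unset Printing Implicit Defensive.

Import Order.TTheory GRing.Theory Num.Theory.
Import numFieldNormedType.Exports.

Local Open Scope classical_set_scope.
Local Open Scope ring_scope.

Definition measure_rV_display : measure_display -> measure_display.
Proof. exact. Qed.

Section rV_measurable.
Context {d} {T : sigmaRingType d} (n : nat).

Let coord (i : 'I_n) (x : 'rV[T]_n) : T := x ord0 i.

Let rV_set0 : g_sigma_preimage coord set0.
Proof. exact: sigma_algebra0. Qed.

Let rV_setC A : g_sigma_preimage coord A -> g_sigma_preimage coord (~` A).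
Proof. exact: sigma_algebraC. Qed.

Let rV_bigcup (F : (set 'rV[T]_n)^nat) :
  (forall i, g_sigma_preimage coord (F i)) ->
  g_sigma_preimage coord (\bigcup_i (F i)).
Proof. exact: sigma_algebra_bigcup. Qed.

HB.instance Definition _ := @isMeasurable.Build (measure_rV_display d)
  'rV[T]_n (g_sigma_preimage coord) rV_set0 rV_setC rV_bigcup.

End rV_measurable.

Lemma measurable_coord {d} {T : sigmaRingType d} n (i : 'I_n) :
  measurable_fun [set: 'rV[T]_n] (fun x : 'rV[T]_n => x ord0 i).
Proof.
move=> _ Y mY; rewrite setTI; apply: sub_sigma_algebra => /=.
rewrite -bigcup_seq/=; exists i => /=; first by rewrite mem_index_enum.
by exists Y => //; rewrite setTI.
Qed.

Lemma measurable_fun_rVP {d1 d2} {T1 : measurableType d1}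
    {T2 : measurableType d2} n (f : T1 -> 'rV[T2]_n) :
  measurable_fun [set: T1] f <->
  forall i, measurable_fun [set: T1] (fun x => f x ord0 i).
Proof.
split=> [mf i|mf].
  exact: (measurableT_comp (measurable_coord i) mf).
apply: (@measurability _ _ _ _ _ _
  (\big[setU/set0]_(i < n) preimage_set_system setT
     (fun x : 'rV[T2]_n => x ord0 i) measurable)) => //.
move=> _ [B + <-]; rewrite -bigcup_seq => -[i _ [C mC <-]].
by rewrite !setTI; rewrite -[X in measurable X]setTI; exact: mf.
Qed.


Section lebesgue_rV.
Context (R : realType).

Definition rV_cons n (p : measurableTypeR R * 'rV[R]_n) : 'rV[R]_n.+1 :=
  \row_i (if unlift ord0 i is Some j then p.2 ord0 j else p.1).

Definition rV_uncons n (x : 'rV[R]_n.+1) : measurableTypeR R * 'rV[R]_n :=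
  (x ord0 ord0, \row_i x ord0 (lift ord0 i)).

Lemma rV_cons0 n (p : measurableTypeR R * 'rV[R]_n) :
  rV_cons p ord0 ord0 = p.1.
Proof. by rewrite mxE unlift_none. Qed.

Lemma rV_consS n (p : measurableTypeR R * 'rV[R]_n) i :
  rV_cons p ord0 (lift ord0 i) = p.2 ord0 i.
Proof. by rewrite mxE liftK. Qed.

Lemma rV_consK n : cancel (@rV_cons n) (@rV_uncons n).
Proof.
move=> [a x]; congr pair; first exact: rV_cons0.
by apply/rowP => i; rewrite mxE rV_consS.
Qed.

Lemma rV_unconsK n : cancel (@rV_uncons n) (@rV_cons n).
Proof.
move=> x; apply/rowP => i.
by case: (unliftP ord0 i) => [j ->|->]; rewrite ?rV_consS ?rV_cons0 ?mxE.
Qed.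

Lemma measurable_rV_cons n : measurable_fun setT (@rV_cons n).
Proof.
apply/measurable_fun_rVP => i; case: (unliftP ord0 i) => [j ->|->].
  under eq_fun do rewrite rV_consS.
  exact: (measurableT_comp (measurable_coord j) measurable_snd).
by under eq_fun do rewrite rV_cons0; exact: measurable_fst.
Qed.

Lemma measurable_rV_uncons n : measurable_fun setT (@rV_uncons n).
Proof.
apply: measurable_fun_pair; first exact: measurable_coord.
apply/measurable_fun_rVP => i; under eq_fun do rewrite mxE.
exact: measurable_coord.
Qed.

Section lebesgue_rV_succ.
Local Open Scope ereal_scope.
Context n (mu : {sigma_finite_measure set 'rV[R]_n -> \bar R}).

Definition lebesgue_rV_succ : set 'rV[R]_n.+1 -> \bar R :=
  pushforward (lebesgue_measure \x mu) (@rV_cons n).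

Let lebesgue_rV_succ0 : lebesgue_rV_succ set0 = 0.
Proof. by rewrite /lebesgue_rV_succ /pushforward preimage_set0 measure0. Qed.

Let lebesgue_rV_succ_ge0 A : 0 <= lebesgue_rV_succ A.
Proof. exact: (measure_ge0 (lebesgue_measure \x mu)). Qed.

Let lebesgue_rV_succ_sigma_additive : semi_sigma_additive lebesgue_rV_succ.
Proof.
move=> F mF tF mUF.
have mpre A : measurable A -> measurable (@rV_cons n @^-1` A).
  by move=> mA; rewrite -[X in measurable X]setTI; exact: measurable_rV_cons.
rewrite /lebesgue_rV_succ /pushforward preimage_bigcup.
apply: measure_semi_sigma_additive.
- by move=> k; exact: mpre.
- apply/trivIsetP => i j _ _ ij; rewrite -preimage_setI.
  by move/trivIsetP : tF => /(_ _ _ _ _ ij) ->//; rewrite preimage_set0.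
- by rewrite -preimage_bigcup; exact: mpre.
Qed.

HB.instance Definition _ := isMeasure.Build _ _ _ lebesgue_rV_succ
  lebesgue_rV_succ0 lebesgue_rV_succ_ge0 lebesgue_rV_succ_sigma_additive.

Let lebesgue_rV_succ_sigma_finite : sigma_finite setT lebesgue_rV_succ.
Proof.
have /sigma_finiteP[F [TF ndF Foo]] := sigma_finiteT (@lebesgue_measure R).
have /sigma_finiteP[G [TG ndG Goo]] := sigma_finiteT mu.
exists (fun k => @rV_uncons n @^-1` (F k `*` G k)).
  rewrite -preimage_bigcup (_ : \bigcup_k _ = setT) ?preimage_setT//.
  apply/seteqP; split=> // -[x y] _.
  have [k _ Fkx] : (\bigcup_k F k) x by rewrite -TF.
  have [l _ Gly] : (\bigcup_k G k) y by rewrite -TG.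
  exists (maxn k l) => //; split.
  - by move: x Fkx; exact/subsetPset/ndF/leq_maxl.
  - by move: y Gly; exact/subsetPset/ndG/leq_maxr.
move=> k; have [mF Fk] := Foo k; have [mG Gk] := Goo k; split.
  rewrite -[X in measurable X]setTI; apply: measurable_rV_uncons => //.
  exact: measurableX.
rewrite /lebesgue_rV_succ /pushforward -comp_preimage.
rewrite (_ : _ \o _ = id) ?preimage_id; last first.
  by apply/funext => p /=; exact: rV_consK.
by rewrite product_measure1E// lte_mul_pinfty// ge0_fin_numE.
Qed.

HB.instance Definition _ := Measure_isSigmaFinite.Build _ _ _
  lebesgue_rV_succ lebesgue_rV_succ_sigma_finite.

End lebesgue_rV_succ.

Fixpoint lebesgue_rV n : {sigma_finite_measure set 'rV[R]_n -> \bar R} :=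
  match n with
  | 0 => \d_(0 : 'rV[R]_0)
  | n'.+1 => lebesgue_rV_succ (lebesgue_rV n')
  end.

Lemma lebesgue_rV_box n (A : 'I_n -> set (measurableTypeR R)) :
  (forall i, measurable (A i)) ->
  lebesgue_rV n [set x | forall i, A i (x ord0 i)] =
  (\prod_(i < n) lebesgue_measure (A i))%E.
Proof.
elim: n A => [|n ih] A mA /=.
  rewrite big_ord0 diracE mem_set//; first by move=> [].
rewrite big_ord_recl -ih//.
rewrite /lebesgue_rV_succ /pushforward (_ : _ @^-1` _ = A ord0 `*`
  [set x : 'rV[R]_n | forall i, A (lift ord0 i) (x ord0 i)]); last first.
  apply/seteqP; split=> [p /= Ap|p [/= A0 AS] i].
    by split=> [|i]/=; [rewrite -(rV_cons0 p)|rewrite -rV_consS].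
  by case: (unliftP ord0 i) => [j ->|->]; rewrite ?rV_consS ?rV_cons0.
rewrite product_measure1E//.
rewrite (_ : [set _ | _] = \bigcap_(i in [set: 'I_n])
    (fun x : 'rV[R]_n => x ord0 i) @^-1` A (lift ord0 i)); last first.
  by apply/seteqP; split=> x /= Ax i; [move=> _; exact: Ax|exact: Ax].
apply: fin_bigcap_measurable => // i _.
rewrite -[X in measurable X]setTI.
exact: (measurable_coord i measurableT (mA (lift ord0 i))).
Qed.

End lebesgue_rV.

Section approximation.
Context (R : realType).

Definition dotp d (x y : 'rV[R]_d) : R :=
  \sum_(i < d) x ord0 i * y ord0 i.

(* Needed because the library norm `|x| on 'rV[R]_d is the maximum norm. *)
Definition enorm d (x : 'rV[R]_d) : R := Num.sqrt (dotp x x).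

Definition unit_ball d : set 'rV[R]_d := [set x | enorm x < 1].

Definition Lnorm_on d (D : set 'rV[R]_d) (p : R) (f : 'rV[R]_d -> R) :
    \bar R :=
  ('N[lebesgue_rV R d]_p%:E[EFin \o (f \_ D)])%E.

(* f in L^p(D) for a measurable D: f \_ D is 0 outside D, so only the values
   of f on D matter. *)
Definition Lfun_on d (D : set 'rV[R]_d) (p : R) (f : 'rV[R]_d -> R) : Prop :=
  f \_ D \in Lfun (lebesgue_rV R d) p%:E.

Definition best_approx d (S : set ('rV[R]_d -> R)) (f : 'rV[R]_d -> R) (p : R)
    (D : set 'rV[R]_d) : \bar R :=
  ereal_inf [set Lnorm_on D p (f \- g) | g in S].

Definition ridge_sums d (sigma : R -> R) (n : nat) : set ('rV[R]_d -> R) :=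
  [set g | exists (a c : 'I_n -> R) (w : 'I_n -> 'rV[R]_d),
     g = fun x => \sum_(j < n) a j * sigma (dotp (w j) x + c j)].

Definition fdiff d (r : nat) (v : 'rV[R]_d) (f : 'rV[R]_d -> R)
    (x : 'rV[R]_d) : R :=
  \sum_(j < r.+1) (-1) ^+ (r - j) * 'C(r, j)%:R * f (x + j%:R *: v).

Definition shift_dom d (D : set 'rV[R]_d) (v : 'rV[R]_d) : set 'rV[R]_d :=
  [set x | D x /\ forall t : R, 0 <= t <= 1 -> D (x + t *: v)].

Definition radial_modulus d (r : nat) (f : 'rV[R]_d -> R) (delta p : R)
    (D : set 'rV[R]_d) : \bar R :=
  ereal_sup [set Lnorm_on (shift_dom D (r%:R *: v)) p (fdiff r v f) |
             v in [set v | enorm v <= delta]].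

Definition logistic (x : R) : R := 1 / (1 + expR (- x)).

Definition cut_power (k : nat) (x : R) : R := if x < 0 then 0 else x ^+ k.

(* A function on [0, +oo[ is represented by an arbitrary extension to R. *)
Record abstract_modulus (w : R -> R) : Prop := AbstractModulus {
  amod_ge0 : forall x : R, 0 <= x -> 0 <= w x ;
  amod_continuous : {within `[0, +oo[, continuous w} ;
  amod_nondecreasing : forall x y : R, 0 <= x -> x <= y -> w x <= w y ;
  amod0 : w 0 = 0 ;
  amod_gt0 : forall d1 : R, 0 < d1 -> 0 < w d1 ;
  amod_leD :
    forall d1 d2 : R, 0 < d1 -> 0 < d2 -> w d1 <= w (d1 + d2) ;
  amod_subadditive :
    forall d1 d2 : R, 0 < d1 -> 0 < d2 -> w (d1 + d2) <= w d1 + w d2 }.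

Definition log2 (x : R) : R := ln x / ln 2.

(* The modulus of smoothness is extended-real valued, hence the explicit O. *)
Definition bigO_right0 (b : R -> \bar R) (a : R -> R) : Prop :=
  exists C : R, \forall delta \near 0^'+, (b delta <= (C * a delta)%:E)%E.

(* For b >= 0 and a > 0 (eventually). *)
Definition not_littleo (b : nat -> \bar R) (a : nat -> R) : Prop :=
  (0 < limn_esup (fun n => b n / (a n)%:E))%E.

End approximation.

(* Main.v *)
Require Import Defs.
From HB Require Import structures.
From mathcomp Require Import all_boot all_order all_algebra.
From mathcomp Require Import all_classical all_reals all_analysis.
From mathcomp Require Import measurable_realfun.
From mathcomp Require Import ring lra zify.

(** The counterexample is a lacunary series [f = \sum_k a_k g_k].  Here
    [theta_k = M_k ^- r], [a_k = w theta_k], and [g_k] is a sum of [M_k ^ d]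
    disjoint smooth bumps on a grid of mesh [1 / (2 d M_k)], carrying signs
    [eps_k] that remain to be chosen.

    The upper bound holds for every choice of signs: an [r]-th difference of
    [g_k] with step at most [delta] is O(min(1, delta ^ r / theta_k)).  When the
    [theta_k] decrease fast, the [a_k] decay geometrically, and the quotients
    [a_k / theta_k] grow geometrically because [w delta / delta] tends to
    infinity; hence [\sum_k a_k min(1, s / theta_k)] is O(w s)
    ([sum_modulus_min]).

    The lower bound is a counting argument.  Fix the partial sum [G] preceding
    [g_k], and sample a network [h] with [n] units on a translate [t] of the
    grid.  At most [(C n M) ^ (C n)] sign patterns of [h - G] occur there
    ([few_patterns]), and when [M ^ d] is a large multiple of [n (1 + log2 n)]
    this is so small that, however a pattern is assigned to each [eps], on average
    [eps] differs from it in a fixed proportion of the nodes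
    ([few_centers_far]).  At a
    node where they differ, [G + a g - h] has modulus at least a constant times
    [a].  Integrating over [t] turns this into an L^p estimate which some [eps]
    satisfies for all [h] simultaneously ([bump_lower_bound]).  The
    pattern count is uniform in the values subtracted from [h], which is why
    [G] may be an arbitrary function, and the later terms of the series are
    uniformly small compared with [a_k].

    The pattern count rests on a bound of Warren type ([sign_patterns]):
    [m] polynomials of degree [D] in [N] variables have at most
    [(2 m D + 1) ^ N] sign patterns.  For every pattern, maximize
    [\prod_i f_i ^ 2 - lam \sum_l x_l ^ E] over the region where the pattern
    holds, with [E] even and larger than the degree of the product.  The
    maximizer is interior, so it is a critical point, and the equations for
    critical points equate [x_l ^ (E - 1)] with a polynomial of lower degree.  Such
    a system has at most [(E - 1) ^ N] solutions, because the
    monomials with all exponents below [E - 1] span all functions on its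
    solution set ([card_solutions]).  A network becomes polynomial in its
    parameters as follows: for a power of the positive part, once the signs of
    the inner affine forms are known; for the logistic function, after clearing
    denominators, since on the lattice the exponential of an affine form is a
    monomial in the exponentials of its coefficients. *)

Set Implicit Arguments.
Unset Strict Implicit.
Unset Printing Implicit Defensive.

Import Order.TTheory GRing.Theory Num.Theory.
Import numFieldNormedType.Exports.

Local Open Scope classical_set_scope.
Local Open Scope ring_scope.

(** * Polynomial functions and systems with pure leading powers *)

Section polynomial_functions.
Context (R : realType) (N : nat).
Implicit Types (f g : 'rV[R]_N -> R) (x y : 'rV[R]_N).

(** Polynomial functions of total degree at most the index.  Derivatives,
    growth and expansion into monomials are all obtained by induction on this
    predicate, and only the values of polynomials ever matter. *)
Inductive polyfun : nat -> ('rV[R]_N -> R) -> Prop :=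
| polyfun_cst k c : polyfun k (fun=> c)
| polyfun_coord k i : polyfun k.+1 (fun x => x ord0 i)
| polyfunD k f g : polyfun k f -> polyfun k g ->
    polyfun k (fun x => f x + g x)
| polyfunM k l f g : polyfun k f -> polyfun l g ->
    polyfun (k + l) (fun x => f x * g x).

Lemma polyfunW k l f : (k <= l)%N -> polyfun k f -> polyfun l f.
Proof.
move=> + pf; elim: pf l => {k f} [k c l _|k i [//|l] _|
  k f g _ ihf _ ihg l kl|k k' f g _ ihf _ ihg l kl].
- exact: polyfun_cst.
- exact: polyfun_coord.
- by apply: polyfunD; [exact: ihf|exact: ihg].
- rewrite -(subnK (leq_trans (leq_addr k' k) kl)) addnC.
  apply: polyfunM; first exact: ihf.
  by apply: ihg; rewrite leq_subRL// (leq_trans _ kl)// leq_addr.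
Qed.

Lemma polyfunN k f : polyfun k f -> polyfun k (fun x => - f x).
Proof.
move=> pf; rewrite (_ : (fun x => _) = (fun x => -1 * f x)).
  by rewrite -[k]add0n; apply: polyfunM => //; exact: polyfun_cst.
by apply/funext => x; rewrite mulN1r.
Qed.

Lemma polyfunB k f g : polyfun k f -> polyfun k g ->
  polyfun k (fun x => f x - g x).
Proof. by move=> pf /polyfunN; exact: polyfunD. Qed.

Lemma polyfunX k f n : polyfun k f -> polyfun (k * n) (fun x => f x ^+ n).
Proof.
move=> pf; elim: n => [|n ih].
  by under eq_fun do rewrite expr0; exact: polyfun_cst.
by under eq_fun do rewrite exprS; rewrite mulnS; exact: polyfunM.
Qed.

Lemma polyfun_sum (I : Type) (s : seq I) (P : pred I)
    (F : I -> 'rV[R]_N -> R) k :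
  (forall i, P i -> polyfun k (F i)) ->
  polyfun k (fun x => \sum_(i <- s | P i) F i x).
Proof.
move=> pF; elim: s => [|i s ih].
  by under eq_fun do rewrite big_nil; exact: polyfun_cst.
have [Pi|/negbTE Pi] := boolP (P i); under eq_fun do rewrite big_cons Pi; last by [].
by apply: polyfunD => //; exact: pF.
Qed.

Lemma polyfun_prod (I : Type) (s : seq I) (P : pred I)
    (F : I -> 'rV[R]_N -> R) (k : I -> nat) :
  (forall i, P i -> polyfun (k i) (F i)) ->
  polyfun (\sum_(i <- s | P i) k i) (fun x => \prod_(i <- s | P i) F i x).
Proof.
move=> pF; elim: s => [|i s ih].
  rewrite big_nil (funext (fun x => big_nil _ _ _ _)).
  exact: polyfun_cst.
rewrite big_cons (funext (fun x => big_cons _ _ _ _ _ _)).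
by case: (boolP (P i)) => // Pi; apply: polyfunM => //; exact: pF.
Qed.

Lemma polyfun_continuous k f : polyfun k f -> continuous f.
Proof.
elim=> {k f} [k c|k i|k f g _ ihf _ ihg|k l f g _ ihf _ ihg] x.
- exact: cst_continuous.
- exact: coord_continuous.
- by apply: continuousD; [exact: ihf|exact: ihg].
- by apply: continuousM; [exact: ihf|exact: ihg].
Qed.

Lemma polyfun_growth k f : polyfun k f -> exists2 C, 0 <= C &
  forall x B, 1 <= B -> (forall i, `|x ord0 i| <= B) -> `|f x| <= C * B ^+ k.
Proof.
elim=> {k f} [k c|k i|k f g _ [C C0 ihf] _ [C' C'0 ihg]|
              k l f g _ [C C0 ihf] _ [C' C'0 ihg]].
- by exists `|c| => // x B B1 _; rewrite ler_peMr// exprn_ege1.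
- exists 1 => // x B B1 xB; rewrite mul1r (le_trans (xB i))//.
  by rewrite exprS ler_peMr ?exprn_ege1// (le_trans ler01).
- exists (C + C'); first exact: addr_ge0.
  move=> x B B1 xB; rewrite mulrDl (le_trans (ler_normD _ _))//.
  by rewrite lerD ?ihf ?ihg.
- exists (C * C'); first exact: mulr_ge0.
  move=> x B B1 xB; rewrite normrM exprD mulrACA.
  by rewrite ler_pM ?ihf ?ihg.
Qed.

(** The bound [k], instead of [k.-1], on the degree of the derivative makes the
    induction uniform in [k]; it costs one unit in the exponent [E] chosen
    later. *)
Lemma polyfun_partial k f (i : 'I_N) : polyfun k f -> exists2 D, polyfun k D &
  forall x (t : R), is_derive t 1 (fun u => f (x + u *: delta_mx ord0 i))
    (D (x + t *: delta_mx ord0 i)).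
Proof.
elim=> {k f} [k c|k j|k f g pf [Df pDf dDf] pg [Dg pDg dDg]|
              k l f g pf [Df pDf dDf] pg [Dg pDg dDg]].
- by exists (fun=> 0); [exact: polyfun_cst|move=> x t; exact: is_derive_cst].
- exists (fun=> (i == j)%:R); first exact: polyfun_cst.
  move=> x t.
  rewrite (_ : (fun u => _) = (fun u => x ord0 j + u * (i == j)%:R)); last first.
    by apply/funext => u; rewrite !mxE eqxx/= eq_sym.
  apply: is_derive_eq.
  by rewrite add0r mul1r scaler0 add0r; exact: mulr1.
- exists (fun x => Df x + Dg x); first exact: polyfunD.
  by move=> x t; exact: is_deriveD.
- exists (fun x => f x * Dg x + g x * Df x).
    by apply: polyfunD; [|rewrite addnC]; exact: polyfunM.
  by move=> x t; exact: is_deriveM.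
Qed.

Definition monomial (b : 'I_N -> nat) x : R := \prod_(i < N) x ord0 i ^+ b i.

Lemma monomial_polyfun b : polyfun (\sum_(i < N) b i) (monomial b).
Proof.
apply: polyfun_prod => i _.
by have := polyfunX (b i) (polyfun_coord 0 i); rewrite mul1n.
Qed.

(** Expansion into monomials, in a form that avoids explicit sums: a property
    stable under linear combinations holds as soon as it holds for
    monomials. *)
Lemma polyfun_monomial_ind k f (P : ('rV[R]_N -> R) -> Prop) :
  polyfun k f ->
  (forall c g, P g -> P (fun x => c * g x)) ->
  (forall g h, P g -> P h -> P (fun x => g x + h x)) ->
  (forall b, (\sum_(i < N) b i <= k)%N -> P (monomial b)) -> P f.
Proof.
move=> pf; elim: pf P => {k f} [k c|k i|k f g _ ihf _ ihg|k l f g _ ihf _ ihg] P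
  PZ PD Pm.
- rewrite (_ : (fun=> c) = (fun x => c * monomial (fun=> 0%N) x)).
    by apply: PZ; apply: Pm; rewrite big1.
  by apply/funext => x; rewrite /monomial big1 ?mulr1//.
- rewrite (_ : (fun x => _) = monomial (fun j => (j == i) : nat)).
    by apply: Pm; rewrite (bigD1 i)//= eqxx big1 ?addn0// => j /negbTE ->.
  apply/funext => x; rewrite /monomial (bigD1 i)//= eqxx expr1 big1 ?mulr1//.
  by move=> j /negbTE ->; rewrite expr0.
- by apply: (PD f g); [exact: (ihf P)|exact: (ihg P)].
- apply: (ihf (fun f => P (fun x => f x * g x))).
  + move=> c f' /(PZ c) Pf'; rewrite (_ : (fun x => _) =
      (fun x => c * (f' x * g x)))//; by apply/funext => x; rewrite mulrA.
  + move=> f1 f2 P1 P2; rewrite (_ : (fun x => _) =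
      (fun x => f1 x * g x + f2 x * g x)); first exact: PD.
    by apply/funext => x; rewrite mulrDl.
  move=> b bk; apply: (ihg (fun g => P (fun x => monomial b x * g x))).
  + move=> c f' /(PZ c) Pf'; rewrite (_ : (fun x => _) =
      (fun x => c * (monomial b x * f' x)))//.
    by apply/funext => x; rewrite mulrCA.
  + move=> f1 f2 P1 P2; rewrite (_ : (fun x => _) =
      (fun x => monomial b x * f1 x + monomial b x * f2 x)); first exact: PD.
    by apply/funext => x; rewrite mulrDr.
  move=> b' bl; rewrite (_ : (fun x => _) = monomial (fun i => b i + b' i)%N).
    by apply: Pm; rewrite big_split leq_add.
  apply/funext => x; rewrite /monomial -big_split/=.
  by apply: eq_bigr => i _; rewrite exprD.
Qed.

(** Every function on the solution set is a combination of the [e.+1 ^ N]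
    monomials with all exponents at most [e]: a monomial with an
    exponent [e.+1] or larger agrees on that set, by one of the equations, with a
    polynomial of smaller total degree.  The number of solutions is the dimension
    of the space of functions on the solution set. *)
Lemma card_solutions (K e : nat) (y : 'I_K -> 'rV[R]_N)
    (D : 'I_N -> 'rV[R]_N -> R) :
  injective y -> (forall i, polyfun e (D i)) ->
  (forall k i, y k ord0 i ^+ e.+1 = D i (y k)) -> (K <= e.+1 ^ N)%N.
Proof.
move=> yinj pD yD.
pose T := {ffun 'I_N -> 'I_e.+1}.
pose W : 'M[R]_(#|{: T}|, K) :=
  \matrix_(a, k) monomial (fun i => (enum_val a : T) i) (y k).
pose P (f : 'rV[R]_N -> R) := (\row_k f (y k) <= W)%MS.
have Pext g h : (forall k, g (y k) = h (y k)) -> P g -> P h.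
  move=> gh; rewrite /P (_ : \row_k g (y k) = \row_k h (y k))//.
  by apply/rowP => k; rewrite !mxE.
have PZ c g : P g -> P (fun x => c * g x).
  rewrite /P => Pg; rewrite (_ : \row_k _ = c *: \row_k g (y k)).
    exact: scalemx_sub.
  by apply/rowP => k; rewrite !mxE.
have PD g h : P g -> P h -> P (fun x => g x + h x).
  rewrite /P => Pg Ph.
  rewrite (_ : \row_k _ = \row_k g (y k) + \row_k h (y k)).
    exact: addmx_sub.
  by apply/rowP => k; rewrite !mxE.
have Preduced (b : 'I_N -> nat) : (forall i, b i <= e)%N -> P (monomial b).
  move=> be; pose a : T := [ffun i => inord (b i)].
  rewrite /P (_ : \row_k _ = row (enum_rank a) W); first exact: row_sub.
  apply/rowP => k; rewrite !mxE enum_rankK; apply: eq_bigr => i _.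
  by rewrite ffunE inordK// ltnS.
have Ppoly n f : polyfun n f -> P f.
  elim/ltn_ind: n f => n ih f pf.
  apply: (@polyfun_monomial_ind n f P pf PZ PD) => b bn.
  have [/forallP be|] := boolP [forall i, b i <= e]%N.
    exact: Preduced.
  rewrite negb_forall => /existsP[i]; rewrite -ltnNge => ebi.
  pose b' j := if j == i then (b i - e.+1)%N else b j.
  have bb' : (\sum_(j < N) b j = e.+1 + \sum_(j < N) b' j)%N.
    rewrite (bigD1 i)//= [in RHS](bigD1 i)//= /b' eqxx addnA subnKC//.
    by congr addn; apply: eq_bigr => j /negbTE ->.
  apply: (Pext (fun x => D i x * monomial b' x)) => [k|].
    rewrite -yD /monomial (bigD1 i)//= [in RHS](bigD1 i)//= mulrA /b' eqxx.
    rewrite -exprD subnKC//; congr (_ * _).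
    by apply: eq_bigr => j /negbTE ->.
  apply: (ih (e + \sum_(j < N) b' j)%N).
    by rewrite (leq_trans _ bn)// bb' addSn ltnS.
  by apply: polyfunM => //; exact: monomial_polyfun.
(* The indicator function of the point [y k] is polynomial: it is a product of
   normalized squared distances to the other points. *)
have Pdelta (k : 'I_K) : P (fun x => \prod_(l | l != k)
    \sum_i (x ord0 i - y l ord0 i) ^+ 2 / \sum_i (y k ord0 i - y l ord0 i) ^+ 2).
  apply: (Ppoly (\sum_(l < K | l != k) (1 * 2 + 0))%N); apply: polyfun_prod => l _.
  apply: polyfun_sum => i _.
  apply: (polyfunM (polyfunX 2 (polyfunB (polyfun_coord 0 i) _)) (polyfun_cst 0 _)).
  exact: polyfun_cst.
have {}Pdelta k : ((delta_mx ord0 k : 'rV[R]_K) <= W)%MS.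
  move: (Pdelta k); rewrite /P; set v := (X in (X <= W)%MS).
  suff -> : v = delta_mx ord0 k by [].
  apply/rowP => l; rewrite !mxE/=; have [->|lk] := eqVneq l k.
    apply: big1 => j jk; rewrite -mulr_suml divff//.
    apply: contra_neq jk => /psumr_eq0P kj0; apply: yinj; apply/rowP => i.
    have /kj0 : forall i, true -> 0 <= (y k ord0 i - y j ord0 i) ^+ 2.
      by move=> ? _; exact: sqr_ge0.
    by move=> /(_ i isT)/eqP; rewrite sqrf_eq0 subr_eq0 => /eqP.
  rewrite (bigD1 l)//= big1 ?mul0r// => i _.
  by rewrite subrr expr0n/= mul0r.
have : (1%:M <= W)%MS.
  by apply/row_subP => k; rewrite rowE mulmx1.
move/mxrankS; rewrite mxrank1 => /leq_trans; apply.
by rewrite (leq_trans (rank_leq_row _))// card_ffun !card_ord.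
Qed.

End polynomial_functions.

(** * Sign patterns of polynomial families *)

Lemma pos_lower_bound (R : realFieldType) (T : finType) (P : pred T) (F : T -> R) :
  (forall t, P t -> 0 < F t) ->
  exists2 e : R, 0 < e & forall t, P t -> e < F t.
Proof.
move=> F0; exists ((\big[Num.min/1]_(t | P t) F t) / 2).
  by rewrite divr_gt0//; apply: lt_bigmin => //; exact: ltr01.
move=> t Pt; rewrite ltr_pdivrMr//.
rewrite (@le_lt_trans _ _ (F t))//; first by rewrite (bigmin_le_cond _ _ Pt).
by rewrite ltr_pMr ?ltr1n// F0.
Qed.

Lemma is_derive_exp (R : realType) (g : R -> R) (t dg : R) n :
  is_derive t 1 g dg ->
  is_derive t 1 (fun v => g v ^+ n.+1) (n.+1%:R * g t ^+ n * dg).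
Proof.
move=> gP; elim: n => [|n ih]; first by rewrite expr0 mulr1 mul1r.
under eq_fun do rewrite exprS.
apply: is_derive_eq.
by rewrite /GRing.scale/= -[n.+2%:R]natr1 exprS; ring.
Qed.

Section sign_patterns.
Context (R : realType) (N : nat) (J : finType) (D : nat).
Variable (f : J -> 'rV[R]_N -> R).
Hypothesis pf : forall i, polyfun D (f i).

Let e := (\sum_(i : J) D * 2)%N.

Let sqf (x : 'rV[R]_N) := \prod_(i : J) f i x ^+ 2.

Let polyfun_sqf : polyfun e sqf.
Proof. by apply: polyfun_prod => i _; exact: polyfunX. Qed.

Let e_even : ~~ odd e.+2.
Proof. by rewrite /= negbK /e -big_distrl/= oddM andbF. Qed.

Let power_ge0 (x : R) : 0 <= x ^+ e.+2.
Proof. by apply: exprn_even_ge0; rewrite e_even. Qed.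

Let sg (s : {ffun J -> bool}) (i : J) : R := (-1) ^+ (~~ s i).

(** The product of the squares is positive inside the region where the
    signs are those of [s] and vanishes on its boundary, and the penalty
    makes the objective negative far away.  The objective is positive at [u], so its
    maximum over the closed region is attained inside, at a critical point. *)
Lemma sign_region_critical_point (lam : R) (s : {ffun J -> bool}) u :
  0 < lam -> (forall i, 0 < sg s i * f i u) ->
  lam * \sum_(l < N) u ord0 l ^+ e.+2 < sqf u ->
  exists2 y, (forall i, 0 < sg s i * f i y) &
    forall (l : 'I_N) (Dl : 'rV[R]_N -> R),
      (forall x (t : R), is_derive t 1 (fun v => sqf (x + v *: delta_mx ord0 l))
         (Dl (x + t *: delta_mx ord0 l))) ->
      Dl y = lam * e.+2%:R * y ord0 l ^+ e.+1.
Proof.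
move=> lam0 su uH.
pose H x := sqf x - lam * \sum_(l < N) x ord0 l ^+ e.+2.
have polyH : polyfun (e + e.+2) H.
  apply: polyfunB; first by apply: polyfunW polyfun_sqf; rewrite leq_addr.
  apply: (@polyfunW _ _ (0 + e.+2)%N); first by rewrite leq_add2r.
  apply: polyfunM; first exact: polyfun_cst.
  apply: polyfun_sum => l _.
  by have := polyfunX e.+2 (polyfun_coord R 0 l); rewrite mul1n.
have [C C0 growth] := polyfun_growth polyfun_sqf.
(* For a point whose largest coordinate has modulus [b > B], the penalty
   [lam * b ^ e.+2] exceeds the bound [C * b ^ e] for the product. *)
pose B := 1 + C / lam.
have B1 : 1 <= B by rewrite lerDl divr_ge0// ltW.
have Hbox x : 0 < H x -> forall l, `|x ord0 l| <= B.
  move=> Hx l; rewrite leNgt; apply/negP => xl.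
  pose l0 := [arg max_(l1 > l | true) `|x ord0 l1|]%O.
  have xl0 j : `|x ord0 j| <= `|x ord0 l0|.
    by rewrite /l0; case: arg_maxP => //= i _; exact.
  set b := `|x ord0 l0| in xl0.
  have bB : B < b by exact: lt_le_trans (xl0 l).
  have b1 : 1 <= b by exact: le_trans (ltW bB).
  have := growth x b b1 xl0; apply/negP; rewrite -ltNge.
  rewrite (lt_le_trans _ (ler_norm _))//.
  move: Hx; rewrite /H subr_gt0; apply: le_lt_trans.
  rewrite (bigD1 l0)//= mulrDr (@le_trans _ _ (lam * b ^+ e.+2))//; last first.
    rewrite /b -normrX ger0_norm// lerDl mulr_ge0// ?(ltW lam0)//.
    by rewrite sumr_ge0.
  rewrite 2!exprS !mulrA ler_wpM2r ?exprn_ge0 ?normr_ge0//.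
  have : C <= lam * b.
    rewrite mulrC -ler_pdivrMr//; apply: le_trans (ltW bB).
    by rewrite lerDr.
  move=> /le_trans; apply; rewrite ler_peMr// mulr_ge0 ?(ltW lam0)//.
  exact: normr_ge0.
pose K := [set x : 'rV[R]_N | forall l, x ord0 l \in `[(- B), B]] `&`
          [set x | forall i, 0 <= sg s i * f i x].
have sgf_cont i : continuous (fun x => sg s i * f i x).
  exact: polyfun_continuous (polyfunM (polyfun_cst N 0 (sg s i)) (pf i)).
have cK : compact K.
  apply: (subclosed_compact _ (@rV_compact _ _ (fun=> `[(- B), B]%classic) _)).
  - apply: closedI.
      rewrite (_ : mkset _ = \bigcap_(l in setT)
        (fun x : 'rV[R]_N => x ord0 l) @^-1` `[(- B), B]%classic).
        apply: closed_bigI => l _; apply: preimage_closed => [x _|].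
          exact: coord_continuous.
        exact: interval_closed.
      by apply/seteqP; split=> x xB l; [move=> _; exact: xB|exact: (xB l I)].
    rewrite (_ : mkset _ = \bigcap_(i in setT)
        (fun x : 'rV[R]_N => sg s i * f i x) @^-1` [set r | 0 <= r]).
      apply: closed_bigI => i _; apply: preimage_closed => [x _|].
        exact: sgf_cont.
      exact: closed_ge.
    by apply/seteqP; split=> x xB l; [move=> _; exact: xB|exact: (xB l I)].
  - by move=> _; exact: segment_compact.
  - by move=> x [].
have Hu : 0 < H u by rewrite subr_gt0.
have uK : K u.
  split=> [l|i]/=; last exact: ltW.
  by rewrite in_itv/= -ler_norml; exact: Hbox.
have [y /set_mem[yB ys] ymax] := @compact_EVT_max _ _ H K (ex_intro _ u uK) cK
   (continuous_subspaceT (polyfun_continuous polyH)).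
have Hy : 0 < H y by apply: (lt_le_trans Hu); apply: ymax; exact: mem_set.
have ymax' x : (forall i, 0 <= sg s i * f i x) -> H x <= H y.
  move=> sx; have [Hx|Hx] := ltP 0 (H x); last exact: (le_trans Hx (ltW Hy)).
  apply: ymax; apply: mem_set; split => //= l.
  by rewrite in_itv/= -ler_norml; exact: Hbox.
have sqfy : 0 < sqf y.
  move: Hy; rewrite subr_gt0; apply: le_lt_trans.
  by rewrite mulr_ge0 ?(ltW lam0)// sumr_ge0.
have sy i : 0 < sg s i * f i y.
  rewrite lt_neqAle ys andbT eq_sym; apply: contraTneq sqfy => sfy.
  rewrite /sqf (bigD1 i)//= (_ : f i y = 0) ?expr0n/= ?mul0r ?ltxx//.
  by move/eqP: sfy; rewrite mulf_eq0 signr_eq0/= => /eqP.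
exists y => // l Dl dDl.
have : \forall t \near (0 : R), forall i, 0 <= sg s i * f i (y + t *: delta_mx ord0 l).
  have := (@filter_forall _ _
    (fun i t => 0 <= sg s i * f i (y + t *: delta_mx ord0 l)) (nbhs (0 : R)) _).
  apply => i.
  have : (fun t : R => sg s i * f i (y + t *: delta_mx ord0 l)) t @[t --> (0:R)]
     --> sg s i * f i (y + (0:R) *: delta_mx ord0 l).
    have [Df _ dDf] := polyfun_partial l (polyfunM (polyfun_cst N 0 (sg s i)) (pf i)).
    have /derivable1_diffP := @ex_derive _ _ _ _ _ _ _ (dDf y 0).
    by move=> /differentiable_continuous.
  rewrite scale0r addr0 => /(cvgr_gt _)/(_ _ (sy i)).
  by apply: filterS => t; exact: ltW.
move=> /nbhs_ballP[c /= c0 cP].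
pose h (t : R) := H (y + t *: delta_mx ord0 l).
have dh (t : R) : is_derive t 1 h (Dl (y + t *: delta_mx ord0 l)
   - lam * e.+2%:R * (y ord0 l + t) ^+ e.+1).
  rewrite /h /H; apply: is_deriveB; rewrite -mulrA; apply: is_deriveZ.
  rewrite (_ : (fun v => _) = (fun v : R => (y ord0 l + v) ^+ e.+2 +
      \sum_(j < N | j != l) y ord0 j ^+ e.+2)); last first.
    apply/funext => v; rewrite (bigD1 l)//= !mxE !eqxx mulr1; congr (_ + _).
    by apply: eq_bigr => j /negbTE jl; rewrite !mxE jl andbF mulr0 addr0.
  rewrite -[X in is_derive _ _ _ X]addr0; apply: is_deriveD.
  rewrite -[X in is_derive _ _ _ X]mulr1; apply: is_derive_exp.
  by rewrite -[X in is_derive _ _ _ X]add0r; apply: is_deriveD.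
have h0 : is_derive (0 : R) 1 h 0.
  apply: (@derive1_at_max _ h (- c) c).
  - by rewrite ge0_cp// ltW.
  - by move=> t _.
  - by rewrite in_itv/= oppr_lt0 c0.
  - move=> t; rewrite in_itv/= => tc; rewrite /h scale0r addr0.
    by apply: ymax' => i; apply: cP; rewrite /ball/= sub0r normrN ltr_norml.
have := @derive_val _ _ _ _ _ _ _ h0.
rewrite (@derive_val _ _ _ _ _ _ _ (dh 0)) scale0r !addr0 => /eqP.
by rewrite subr_eq0 => /eqP.
Qed.

(** Distinct patterns have disjoint regions, hence distinct critical points of
    the same objective function, and these points solve a system to which
    [card_solutions] applies. *)
Lemma strict_sign_patterns (S : {set {ffun J -> bool}}) :
  (forall s, s \in S -> exists u, forall i, 0 < sg s i * f i u) ->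
  (#|S| <= e.+1 ^ N)%N.
Proof.
move=> Su.
have /choice[u uP] : forall s, exists u, s \in S -> forall i, 0 < sg s i * f i u.
  move=> s; have [/Su[u us]|_] := boolP (s \in S); first by exists u.
  by exists 0.
have sqfu s : s \in S -> 0 < sqf (u s).
  move=> /uP us; apply: prodr_gt0 => i _; rewrite exprn_even_gt0//=.
  by apply: contraTneq (us i) => ->; rewrite mulr0 ltxx.
pose V s := 1 + \sum_(l < N) u s ord0 l ^+ e.+2.
have V0 s : 0 < V s by rewrite ltr_wpDr// sumr_ge0.
have [lam lam0 lamP] : exists2 lam : R, 0 < lam &
    forall s, s \in S -> lam < sqf (u s) / V s.
  by apply: pos_lower_bound => s /sqfu sqs; rewrite divr_gt0.
have /choice[y yP] : forall s, exists y, s \in S ->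
    (forall i, 0 < sg s i * f i y) /\
    forall (l : 'I_N) (Dl : 'rV[R]_N -> R),
      (forall x (t : R), is_derive t 1 (fun v => sqf (x + v *: delta_mx ord0 l))
         (Dl (x + t *: delta_mx ord0 l))) ->
      Dl y = lam * e.+2%:R * y ord0 l ^+ e.+1.
  move=> s; have [sS|_] := boolP (s \in S); last by exists 0.
  have [|y y1 y2] := @sign_region_critical_point lam s (u s) lam0 (uP _ sS).
    have := lamP _ sS; rewrite ltr_pdivlMr//; apply: le_lt_trans.
    by rewrite ler_pM2l// lerDr.
  by exists y.
have /choice[Dq DqP] : forall l, exists Dl, polyfun e Dl /\
      (forall x (t : R), is_derive t 1 (fun v => sqf (x + v *: delta_mx ord0 l))
         (Dl (x + t *: delta_mx ord0 l))).
  by move=> l; have [Dl ? ?] := polyfun_partial l polyfun_sqf; exists Dl.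
apply: (@card_solutions R N #|S| e (fun k => y (enum_val k))
  (fun l x => (lam * e.+2%:R)^-1 * Dq l x)).
- move=> k k' /= yk; apply: enum_val_inj; apply/ffunP => i.
  have [+ _] := yP _ (enum_valP k); have [+ _] := yP _ (enum_valP k').
  rewrite yk => /(_ i) + /(_ i); rewrite /sg.
  case: (enum_val k i); case: (enum_val k' i) => //=;
    rewrite expr0 expr1 => h1 h2; lra.
- move=> l; rewrite -[e]add0n; apply: polyfunM; first exact: polyfun_cst.
  by have [] := DqP l.
- move=> k l; have [_ yD] := yP _ (enum_valP k).
  have [_ /yD ->] := DqP l; rewrite mulKf// mulf_neq0 ?pnatr_eq0//.
  by rewrite gt_eqF.
Qed.

End sign_patterns.

(** A form of Warren's theorem.  Patterns in which zero counts as not positive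
    are made strict by subtracting a small [tau] from all the polynomials,
    below every positive value taken at the finitely many witnesses. *)
Lemma sign_patterns (R : realType) (N : nat) (J : finType) (D : nat)
    (f : J -> 'rV[R]_N -> R) (S : {set {ffun J -> bool}}) :
  (forall i, polyfun D (f i)) ->
  (forall s, s \in S -> exists u, forall i, s i = (0 < f i u)) ->
  (#|S| <= (#|J| * (D * 2)).+1 ^ N)%N.
Proof.
move=> pf /= Su.
have /choice[u uP] : forall s, exists u, s \in S -> forall i, s i = (0 < f i u).
  move=> s; have [/Su[u us]|_] := boolP (s \in S); first by exists u.
  by exists 0.
have [tau tau0 tauP] : exists2 tau : R, 0 < tau &
    forall t : {ffun J -> bool} * J, 0 < f t.2 (u t.1) -> tau < f t.2 (u t.1).
  exact: (@pos_lower_bound R _ (fun t => 0 < f t.2 (u t.1))).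
have pf' i : polyfun D (fun x => f i x - tau).
  by apply: polyfunB => //; exact: polyfun_cst.
have := @strict_sign_patterns R N J D (fun i x => f i x - tau) pf' S.
rewrite sum_nat_const; apply => s sS; exists (u s) => i; rewrite uP//.
have [fu|fu] := ltP 0 (f i (u s)).
  by rewrite expr0 mul1r subr_gt0; exact: (tauP (s, i)).
by rewrite expr1 mulN1r oppr_gt0 subr_lt0 (le_lt_trans fu).
Qed.

(** * Sign patterns of networks on a grid *)

Lemma card_bigcup_leq (T I : finType) (A : {set I}) (F : I -> {set T}) B :
  (forall i, i \in A -> #|F i| <= B)%N ->
  (#|(\bigcup_(i in A) F i)%SET| <= #|A| * B)%N.
Proof.
move=> FB; rewrite -sum_nat_const.
apply: (@leq_trans (\sum_(i in A) #|F i|)); last exact: leq_sum.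
elim/big_ind2 : _ => [|m1 n1 m2 n2 h1 h2|//]; first by rewrite cards0.
by rewrite (leq_trans (leq_card_setU _ _).1)// leq_add.
Qed.

Lemma leq_expn m n k : (m <= n)%N -> (m ^ k <= n ^ k)%N.
Proof. by case: k => // k mn; rewrite leq_exp2r. Qed.

Section ridge_patterns.
Context (R : realType) (d : nat).
Implicit Type sigma : R -> R.

Definition grid_point (M : nat) (L : R) (t : 'rV[R]_d)
  (z : {ffun 'I_d -> 'I_M}) : 'rV[R]_d := \row_l (t ord0 l + (z l)%:R / L).

(** The threshold [b] stands for the values at the nodes of the part of the
    counterexample that has already been built. *)
Definition ridge_patterns sigma n (Z : finType) (x : Z -> 'rV[R]_d)
    (b : Z -> R) : {set {ffun Z -> bool}} :=
  finset (fun s : {ffun Z -> bool} =>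
    `[< exists2 h, ridge_sums sigma n h & forall z, s z = (b z < h (x z)) >]).

(** The single constant [C] absorbs both the base and the exponent; it may depend
    on [d] and [sigma], but not on the grid or on the thresholds. *)
Definition few_patterns sigma (C : nat) :=
  forall (n M : nat) (L : R) (t : 'rV[R]_d) b, (0 < n)%N -> (0 < M)%N -> 0 < L ->
  (#|ridge_patterns sigma n (@grid_point M L t) b| <= (C * n * M) ^ (C * n))%N.

Lemma few_patterns_bound sigma C e :
  (forall (n M : nat) (L : R) (t : 'rV[R]_d) b,
     (0 < n)%N -> (0 < M)%N -> 0 < L ->
     (#|ridge_patterns sigma n (@grid_point M L t) b| <=
      (C * n * M) ^ (e * n))%N) ->
  few_patterns sigma (C + e).+1.
Proof.
move=> H n M L t b n0 M0 L0; apply: (leq_trans (H _ _ _ _ _ n0 M0 L0)).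
apply: (@leq_trans (((C + e).+1 * n * M) ^ (e * n))%N).
  by case: (e * n)%N => // k; rewrite leq_exp2r// !leq_mul2r leqW ?leq_addr ?orbT.
by rewrite leq_pexp2l ?muln_gt0 ?n0// leq_mul2r leqW ?leq_addl ?orbT.
Qed.

Section parameters.
Context (n : nat).

(** The [n * (d + 2)] parameters of a network with [n] units form one row
    vector, so that [sign_patterns] applies to polynomials in them. *)
Definition param_index (j : 'I_n) (k : 'I_d.+2) : 'I_(n * d.+2) := mxvec_index j k.

Definition outer_weight (x : 'rV[R]_(n * d.+2)) j := x ord0 (param_index j ord0).
Definition bias (x : 'rV[R]_(n * d.+2)) j := x ord0 (param_index j (lift ord0 ord0)).
Definition inner_weight (x : 'rV[R]_(n * d.+2)) j l :=
  x ord0 (param_index j (lift ord0 (lift ord0 l))).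

Lemma parametersP (a c : 'I_n -> R) (w : 'I_n -> 'I_d -> R) :
  exists x, [/\ outer_weight x =1 a, bias x =1 c & inner_weight x =2 w].
Proof.
exists (mxvec (\matrix_(j, k) match unlift ord0 k with
  | None => a j
  | Some k' => match unlift ord0 k' with None => c j | Some l => w j l end end)).
by split=> [j|j|j l]; rewrite /outer_weight /bias /inner_weight mxvecE mxE;
  rewrite ?unlift_none ?liftK ?unlift_none ?liftK.
Qed.

End parameters.

(** In the variables [exp (- w_l / L)] and [exp (- (w . t + c))] the number
    [exp (- (w . x + c))] is a monomial at every node [x] of the grid, of degree
    at most [1 + d M].  Multiplying by the positive common denominator of the
    units preserves signs and leaves a polynomial in the new variables and in
    the outer weights. *)
Lemma logistic_few_patterns : exists C, few_patterns (@logistic R) C.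
Proof.
exists ((2 * d.+2).+2 + (d.+1 * d.+2)).+1.
apply: few_patterns_bound => n M L t b n0 M0 L0.
pose Z := {ffun 'I_d -> 'I_M}.
pose E (x : 'rV[R]_(n * d.+2)) (z : Z) j :=
  bias x j * \prod_(l < d) inner_weight x j l ^+ z l.
have pE z j : polyfun (1 + d * M) (fun x => E x z j).
  apply: polyfunM; first exact: polyfun_coord.
  rewrite -[d in (d * M)%N]card_ord -sum_nat_const.
  apply: polyfun_prod => l _; apply: (@polyfunW _ _ (1 * z l)%N).
    by rewrite mul1n ltnW.
  by apply: polyfunX; exact: polyfun_coord.
have pE1 z j : polyfun (1 + d * M) (fun x => 1 + E x z j).
  by apply: polyfunD => //; exact: polyfun_cst.
pose D := (1 + n * (1 + d * M))%N.
pose F z x := \sum_j outer_weight x j * \prod_(i | i != j) (1 + E x z i)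
   - b z * \prod_i (1 + E x z i).
have pF z : polyfun D (F z).
  apply: polyfunB.
    apply: polyfun_sum => j _.
    apply: polyfunM; first exact: polyfun_coord.
    apply: (@polyfunW _ _ (\sum_(i < n | i != j) (1 + d * M))).
      rewrite sum_nat_const leq_mul2r; apply/orP; right.
      by rewrite (leq_trans (max_card _))// card_ord.
    exact: polyfun_prod.
  apply: (@polyfunW _ _ (0 + \sum_(i < n) (1 + d * M))).
    by rewrite sum_nat_const card_ord /D leq_add2r.
  apply: polyfunM; first exact: polyfun_cst.
  exact: polyfun_prod.
apply: (leq_trans (@sign_patterns R (n * d.+2) Z D F _ pF _)).
  move=> s; rewrite inE => /asboolP[h [a [c [w ->]]] sh].
  have [x [xa xc xw]] := @parametersP n a
    (fun j => expR (- (dotp (w j) t + c j)))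
    (fun j l => expR (- (w j ord0 l / L))).
  exists x => z; rewrite sh.
  have EE j : E x z j = expR (- (dotp (w j) (grid_point L t z) + c j)).
    rewrite /E xc; under eq_bigr do rewrite xw -expRM_natr.
    rewrite -expR_sum -expRD; congr expR.
    rewrite /dotp; under [in RHS]eq_bigr do rewrite mxE mulrDr.
    rewrite big_split/= [in RHS]addrAC [in RHS]opprD; congr (_ + _).
    rewrite -sumrN; apply: eq_bigr => l _.
    by rewrite mulNr -mulrA [_^-1 * _]mulrC.
  have E1 j : 0 < 1 + E x z j by rewrite EE addr_gt0// expR_gt0.
  have Pi0 : 0 < \prod_i (1 + E x z i) by apply: prodr_gt0 => i _.
  rewrite -subr_gt0 -(pmulr_lgt0 _ Pi0) /F mulrBl mulr_suml.
  congr (0 < _ - _); apply: eq_bigr => j _.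
  rewrite xa (bigD1 j)//= mulrA; congr (_ * _).
  by rewrite /logistic -EE mul1r -mulrA mulVf ?mulr1// gt_eqF.
set B := (_ * n * M)%N.
have nM : (0 < n * M)%N by rewrite muln_gt0 n0.
suff KB : ((#|{: Z}| * (D * 2)).+1 <= B ^ d.+1)%N.
  apply: (@leq_trans ((B ^ d.+1) ^ (n * d.+2))%N).
    by rewrite leq_exp2r// muln_gt0 n0.
  by rewrite -expnM leq_eqVlt -mulnA (mulnC n) eqxx.
have DM : (D <= d.+2 * (n * M))%N.
  rewrite /D !mulSn mulnDr muln1 leq_add// leq_add//.
    by rewrite leq_pmulr.
  by rewrite mulnCA.
have MB : (M <= B)%N by rewrite leq_pmull// muln_gt0.
have DB : ((D * 2).+1 <= B)%N.
  have -> : B = (2 * (d.+2 * (n * M)) + n * M + n * M)%N by rewrite /B; ring.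
  by lia.
rewrite card_ffun !card_ord expnSr.
apply: (@leq_trans (M ^ d * (D * 2).+1)).
  by rewrite mulnS; have := expn_gt0 M d; rewrite M0/=; lia.
by rewrite leq_mul// leq_expn.
Qed.

(** The signs of the inner affine forms, which are linear in the parameters, are
    counted first.  When they are prescribed, the network is a polynomial of degree
    [k + 2] in its parameters, and the outer signs are counted. *)
Lemma cut_power_few_patterns k : exists C, few_patterns (@cut_power R k.+1) C.
Proof.
exists ((2 * k.+2).+2 + (2 * (d.+1 * d.+2))).+1.
apply: few_patterns_bound => n M L t b n0 M0 L0.
pose Z := {ffun 'I_d -> 'I_M}.
pose q (jz : 'I_n * Z) (x : 'rV[R]_(n * d.+2)) :=
  \sum_(l < d) inner_weight x jz.1 l * grid_point L t jz.2 ord0 l + bias x jz.1.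
have pq jz : polyfun 1 (q jz).
  apply: polyfunD; last exact: polyfun_coord.
  apply: polyfun_sum => l _.
  by apply: (@polyfunM _ _ 1 0); [exact: polyfun_coord|exact: polyfun_cst].
pose S1 := finset (fun A : {ffun 'I_n * Z -> bool} =>
  `[< exists x, forall jz, A jz = (0 < q jz x) >]).
pose F (A : {ffun 'I_n * Z -> bool}) z x :=
  \sum_j outer_weight x j * (if A (j, z) then q (j, z) x ^+ k.+1 else 0) - b z.
have pF A z : polyfun k.+2 (F A z).
  apply: polyfunB; last exact: polyfun_cst.
  apply: polyfun_sum => j _.
  apply: (@polyfunM _ _ 1 k.+1); first exact: polyfun_coord.
  case: (A (j, z)); last exact: polyfun_cst.
  by have := polyfunX k.+1 (pq (j, z)); rewrite mul1n.
pose S2 A := finset (fun s : {ffun Z -> bool} =>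
  `[< exists x, forall z, s z = (0 < F A z x) >]).
have sub : ridge_patterns (@cut_power R k.+1) n (@grid_point M L t) b \subset
    (\bigcup_(A in S1) S2 A)%SET.
  apply/fintype.subsetP => s; rewrite inE => /asboolP[h [a [c [w ->]]] sh].
  have [x [xa xc xw]] := @parametersP n a c (fun j l => w j ord0 l).
  have qE j z : q (j, z) x = dotp (w j) (grid_point L t z) + c j.
    by rewrite /q/= xc; congr (_ + _); apply: eq_bigr => l _; rewrite xw.
  pose A : {ffun 'I_n * Z -> bool} := [ffun jz => 0 < q jz x].
  apply/bigcupP; exists A; rewrite inE; apply/asboolP; exists x.
    by move=> jz; rewrite ffunE.
  move=> z; rewrite sh -subr_gt0 /F; congr (0 < _ - _).
  apply: eq_bigr => j _; rewrite xa ffunE qE /cut_power; congr (_ * _).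
  by case: ltgtP => // ->; rewrite expr0n.
apply: (leq_trans (subset_leq_card sub)).
set B := (_ * n * M)%N.
have nM : (0 < n * M)%N by rewrite muln_gt0 n0.
have MB : (M <= B)%N by rewrite leq_pmull// muln_gt0.
have B0 : (0 < B)%N by rewrite !muln_gt0 n0.
have S1B : (#|S1| <= (B ^ d.+1) ^ (n * d.+2))%N.
  apply: (leq_trans (@sign_patterns R (n * d.+2) _ 1 q _ pq _)).
    by move=> s; rewrite inE => /asboolP.
  rewrite leq_exp2r ?muln_gt0 ?n0// card_prod card_ffun !card_ord mul1n.
  have MdB : (M ^ d <= B ^ d)%N by exact: leq_expn.
  rewrite expnS (@leq_trans ((2 * n).+1 * M ^ d)%N)//.
    by have := expn_gt0 M d; rewrite M0/=; lia.
  rewrite leq_mul// /B -mulnA.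
  have : (n <= n * M)%N by rewrite leq_pmulr.
  by nia.
have S2B A : A \in S1 -> (#|S2 A| <= (B ^ d.+1) ^ (n * d.+2))%N.
  move=> _.
  apply: (leq_trans (@sign_patterns R (n * d.+2) _ k.+2 (F A) _ (pF A) _)).
    by move=> s; rewrite inE => /asboolP.
  rewrite leq_exp2r ?muln_gt0 ?n0// card_ffun !card_ord.
  have MdB : (M ^ d <= B ^ d)%N by exact: leq_expn.
  rewrite expnS (@leq_trans ((k.+2 * 2).+1 * M ^ d)%N)//.
    by have := expn_gt0 M d; rewrite M0/=; lia.
  by rewrite leq_mul// /B -mulnA; nia.
apply: (leq_trans (card_bigcup_leq S2B)).
apply: (leq_trans (leq_mul S1B (leqnn _))).
rewrite -expnD addnn -mul2n -expnM leq_pexp2l//.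
by rewrite leq_eqVlt; apply/orP; left; apply/eqP; ring.
Qed.

End ridge_patterns.

(** * Hamming distance to a small set of patterns *)

Section hamming.
Local Open Scope nat_scope.
Variable Z : finType.
Implicit Types s t : {ffun Z -> bool}.

Definition hamming s t := \sum_z (s z != t z : nat).

Lemma hamming_le s t : hamming s t <= #|Z|.
Proof.
rewrite -sum1_card; apply: leq_sum => z _; exact: leq_b1.
Qed.

(** Generating function of the Hamming distance to [t] at [1 / 2], multiplied by
    [2 ^ #|Z|]. *)
Lemma sum_hamming_weight t :
  \sum_s 2 ^ (#|Z| - hamming s t) = 3 ^ #|Z|.
Proof.
transitivity (\sum_(s : {ffun Z -> bool}) \prod_z (if s z != t z then 1 else 2)).
  apply: eq_bigr => s _; apply/eqP.
  rewrite -(@eqn_pmul2r (2 ^ hamming s t)) ?expn_gt0//.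
  apply/eqP; rewrite -expnD subnK ?hamming_le//.
  rewrite /hamming expn_sum -big_split/= -prod_nat_const.
  by apply: eq_bigr => z _; case: (s z != t z).
rewrite -(bigA_distr_bigA (fun z b => if b != t z then 1 else 2)) -prod_nat_const.
by apply: eq_bigr => z _; rewrite big_bool; case: (t z).
Qed.

(** The weight [2 ^ (#|Z| - hamming s (pi s))] summed over all [s] is at most
    [#|S| * 3 ^ #|Z|].  Bounding the exponential from below by its tangent at
    distance [K] turns this into a lower bound for the mean distance, and the
    hypotheses make [2 ^ K * #|S| * 3 ^ #|Z|] at most [4 ^ #|Z|]. *)
Lemma few_centers_far (S : {set {ffun Z -> bool}}) K
    (pi : {ffun Z -> bool} -> {ffun Z -> bool}) :
  (forall s, pi s \in S) -> #|S| <= 4 ^ K -> 8 * K <= #|Z| ->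
  K * 2 ^ #|Z| <= \sum_s hamming s (pi s).
Proof.
move=> piS SK KZ; set m := #|Z| in KZ *.
have weight : \sum_s 2 ^ (m - hamming s (pi s)) <= #|S| * 3 ^ m.
  apply: (@leq_trans (\sum_s \sum_(t in S) 2 ^ (m - hamming s t))).
    apply: leq_sum => s _; rewrite (bigD1 (pi s))//=; exact: leq_addr.
  rewrite exchange_big/= -sum_nat_const; apply: leq_sum => t _.
  by rewrite sum_hamming_weight.
have big : 8 ^ K * 3 ^ m <= 2 ^ m * 2 ^ m.
  rewrite -(subnK KZ) expnD -expnMn expnD mulnCA mulnA -mulnA leq_mul//.
    exact: leq_expn.
  by rewrite !expnM -expnMn leq_expn.
(* This is [1 + K - x <= 2 ^ (K - x)], scaled to natural numbers. *)
have tangent s : 2 ^ m * K.+1 <=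
    2 ^ K * 2 ^ (m - hamming s (pi s)) + 2 ^ m * hamming s (pi s).
  have := hamming_le s (pi s); rewrite -/m; set x := hamming _ _ => xm.
  have [xK|Kx] := leqP x K; last first.
    by apply: (leq_trans _ (leq_addl _ _)); rewrite leq_mul2l Kx orbT.
  have -> : 2 ^ K * 2 ^ (m - x) = 2 ^ m * 2 ^ (K - x).
    by rewrite -!expnD; congr (2 ^ _); lia.
  rewrite -mulnDr leq_mul2l; apply/orP; right.
  by have := ltn_expl (K - x) (isT : 1 < 2); lia.
have := leq_sum (index_enum {ffun Z -> bool}) (P := predT) (fun s _ => tangent s).
rewrite sum_nat_const big_split/= -!big_distrr/= card_ffun card_bool -/m => tot.
rewrite -(@leq_pmul2l (2 ^ m)) ?expn_gt0//.
have : 2 ^ K * \sum_s 2 ^ (m - hamming s (pi s)) <= 2 ^ m * 2 ^ m.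
  apply: leq_trans big; rewrite (_ : 8 = 2 * 4)// expnMn -mulnA leq_mul2l.
  by rewrite (leq_trans weight) ?orbT// leq_mul2r SK orbT.
move: tot; rewrite mulnS mulnDr (mulnC K) => tot h.
by rewrite -(leq_add2l (2 ^ m * 2 ^ m)) (leq_trans tot)// leq_add2r.
Qed.

End hamming.

(** * Functions with dominated derivatives *)

Section dominated_smoothness.
Context (R : realType).
Implicit Types (u v D : R -> R) (s t h : R).

(** The first [k] derivatives exist everywhere and, together with [u], are
    bounded pointwise by [D].  A bound by a function, and not by a constant,
    lets derivatives of functions with disjoint supports be added without
    loss. *)
Fixpoint dsmooth k D u : Prop :=
  (forall s, `|u s| <= D s) /\
  if k is k'.+1 then
    exists2 u', (forall s, is_derive s 1 u (u' s)) & dsmooth k' D u'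
  else True.

Lemma dsmooth_bound k D u s : dsmooth k D u -> `|u s| <= D s.
Proof. by case: k => [|k] [+ _]; exact. Qed.

Lemma dsmooth_dom_ge0 k D u s : dsmooth k D u -> 0 <= D s.
Proof. by move=> /dsmooth_bound uD; exact: le_trans (uD s). Qed.

Lemma dsmooth_le k D D' u : (forall s, D s <= D' s) ->
  dsmooth k D u -> dsmooth k D' u.
Proof.
move=> DD'; elim: k u => [|k ih] u [uD].
  by split=> // s; exact: le_trans (DD' s).
move=> [u' du /ih u'D]; split; last by exists u'.
by move=> s; exact: le_trans (DD' s).
Qed.

Lemma dsmoothS k D u : dsmooth k.+1 D u -> dsmooth k D u.
Proof.
elim: k u => [|k ih] u [uD] [u' du u'D]; first by split.
by split=> //; exists u' => //; exact: ih.
Qed.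

Lemma dsmooth0 k : dsmooth k (fun=> 0) (fun=> 0).
Proof.
elim: k => [|k ih]; first by split=> // s; rewrite normr0.
split=> [s|]; first by rewrite normr0.
by exists (fun=> 0) => // s; exact: is_derive_cst.
Qed.

Lemma dsmooth1 k : dsmooth k (fun=> 1) (fun=> 1).
Proof.
case: k => [|k]; first by split=> // s; rewrite normr1.
split=> [s|]; first by rewrite normr1.
exists (fun=> 0) => [s|]; first exact: is_derive_cst.
 apply: dsmooth_le (dsmooth0 k) => s; exact: ler01.
Qed.

Lemma dsmoothD k D D' u v : dsmooth k D u -> dsmooth k D' v ->
  dsmooth k (fun s => D s + D' s) (fun s => u s + v s).
Proof.
elim: k u v => [|k ih] u v [uD] => [_ [vD _]|[u' du u'D] [vD [v' dv v'D]]].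
  by split=> // s; rewrite (le_trans (ler_normD _ _))// lerD.
split=> [s|]; first by rewrite (le_trans (ler_normD _ _))// lerD.
by exists (fun s => u' s + v' s); [move=> s; exact: is_deriveD|exact: ih].
Qed.

Lemma dsmoothZ k D c u : dsmooth k D u ->
  dsmooth k (fun s => `|c| * D s) (fun s => c * u s).
Proof.
elim: k u => [|k ih] u [uD] => [_|[u' du u'D]].
  by split=> // s; rewrite normrM ler_wpM2l.
split=> [s|]; first by rewrite normrM ler_wpM2l.
by exists (fun s => c * u' s); [move=> s; exact: is_deriveZ|exact: ih].
Qed.

(** Leibniz's rule; each derivative of a product doubles the number of terms. *)
Lemma dsmoothM k D D' u v : dsmooth k D u -> dsmooth k D' v ->
  dsmooth k (fun s => 2 ^+ k * (D s * D' s)) (fun s => u s * v s).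
Proof.
elim: k u v => [|k ih] u v uk vk.
  move: uk vk => [uD _] [vD _]; split=> // s.
  by rewrite expr0 mul1r normrM ler_pM.
have [[uD [u' du u'D]] [vD [v' dv v'D]]] := (uk, vk).
split=> [s|].
  rewrite normrM; apply: (@le_trans _ _ (D s * D' s)); first exact: ler_pM.
  rewrite ler_peMl ?exprn_ege1 ?ler1n//.
  by rewrite mulr_ge0 ?(dsmooth_dom_ge0 s uk) ?(dsmooth_dom_ge0 s vk).
exists (fun s => u s * v' s + v s * u' s); first by move=> s; exact: is_deriveM.
have h1 := ih _ _ (dsmoothS uk) v'D.
have h2 := ih _ _ u'D (dsmoothS vk).
apply: (dsmooth_le _ (dsmoothD h1 _)) => [s|]; last first.
  by under eq_fun do rewrite mulrC; exact: h2.
by rewrite exprS; lra.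
Qed.

Lemma dsmooth_sum k (I : Type) (r : seq I) (D u : I -> R -> R) :
  (forall i, dsmooth k (D i) (u i)) ->
  dsmooth k (fun s => \sum_(i <- r) D i s) (fun s => \sum_(i <- r) u i s).
Proof.
move=> uD; elim: r => [|i r ih].
  by under eq_fun do rewrite big_nil; under [X in dsmooth _ _ X]eq_fun do rewrite big_nil;
     exact: dsmooth0.
under eq_fun do rewrite big_cons;
under [X in dsmooth _ _ X]eq_fun do rewrite big_cons.
exact: dsmoothD.
Qed.

Lemma dsmooth_prod k (I : Type) (r : seq I) (D u : I -> R -> R) :
  (forall i, dsmooth k (D i) (u i)) ->
  dsmooth k (fun s => \prod_(i <- r) (2 ^+ k * D i s))
    (fun s => \prod_(i <- r) u i s).
Proof.
move=> uD; elim: r => [|i r ih].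
  by under eq_fun do rewrite big_nil; under [X in dsmooth _ _ X]eq_fun do rewrite big_nil;
     exact: dsmooth1.
under eq_fun do rewrite big_cons;
under [X in dsmooth _ _ X]eq_fun do rewrite big_cons.
under eq_fun do rewrite -mulrA.
exact: dsmoothM.
Qed.

Lemma dsmooth_affine k D u a b : `|a| <= 1 -> dsmooth k D u ->
  dsmooth k (fun s => D (a * s + b)) (fun s => u (a * s + b)).
Proof.
move=> a1; elim: k u => [|k ih] u [uD] => [_|[u' du u'D]].
  by split=> // s.
split=> [s //|].
exists (fun s => a * u' (a * s + b)).
  move=> s; rewrite mulrC; apply: (@is_derive1_comp _ u (fun s => a * s + b)).
  rewrite -[X in is_derive _ _ _ X]addr0; apply: is_deriveD.
  by rewrite -[X in is_derive _ _ _ X]mulr1; exact: is_deriveZ.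
apply: (dsmooth_le _ (dsmoothZ a (ih _ u'D))) => s.
by rewrite ler_piMl// (dsmooth_dom_ge0 _ u'D).
Qed.

Definition ndiff k h u s :=
  \sum_(j < k.+1) (-1) ^+ (k - j) * 'C(k, j)%:R * u (s + j%:R * h).

Lemma ndiffS k h u s :
  ndiff k.+1 h u s = ndiff k h (fun s => u (s + h) - u s) s.
Proof.
pose a j := u (s + j%:R * h).
transitivity (\sum_(j < k.+1) (-1) ^+ (k - j) * 'C(k, j)%:R * (a j.+1 - a j)).
  rewrite /ndiff big_ord_recl/=.
  under eq_bigr => i _ do rewrite /bump/= add1n subSS binS natrD mulrDr mulrDl.
  under [RHS]eq_bigr do rewrite mulrBr.
  rewrite big_split/= sumrB addrA addrC; congr (_ + _).
  rewrite big_ord_recr/= (@bin_small k k.+1)// mulr0 mul0r addr0.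
  rewrite [in RHS]big_ord_recl/= !subn0 !bin0 opprD exprS !mulN1r !mulr1 mulNr.
  congr (_ + _); rewrite -sumrN; apply: eq_bigr => i _.
  rewrite /bump/= add1n -2!mulNr; congr (_ * _ * _).
  by rewrite -(subnSK (ltn_ord i)) exprS mulN1r.
apply: eq_bigr => j _; rewrite /a; congr (_ * (u _ - u _)).
by rewrite -natr1 mulrDl mul1r addrA.
Qed.

(** By the mean value theorem applied to [u] and to each of its first [k]
    derivatives. *)
Lemma dsmooth_shiftB k B u h : dsmooth k.+1 (fun=> B) u ->
  dsmooth k (fun=> `|h| * B) (fun s => u (s + h) - u s).
Proof.
have lip v v' s : (forall s, is_derive s 1 v (v' s)) -> (forall s, `|v' s| <= B) ->
    `|v (s + h) - v s| <= `|h| * B.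
  move=> dv v'B.
  have cv : continuous v.
    move=> t; apply: differentiable_continuous; apply/derivable1_diffP.
    exact: (@ex_derive _ _ _ _ _ _ _ (dv t)).
  have [h0|h0] := leP 0 h.
    have [|c _ ->] := @MVT_segment _ v v' s (s + h) _ (fun x _ => dv x)
        (continuous_subspaceT cv).
      by rewrite lerDl.
    by rewrite addrC addKr normrM mulrC ler_wpM2l.
  rewrite distrC; have [|c _ ->] := @MVT_segment _ v v' (s + h) s _ (fun x _ => dv x)
        (continuous_subspaceT cv).
    by rewrite gerDl ltW.
  by rewrite opprD addNKr normrM normrN mulrC ler_wpM2l.
elim: k u => [|k ih] u [uD [u' du u'D]].
  split=> // s; apply: (lip _ u' s du) => t; by case: u'D.
split.
  by move=> s; apply: (lip _ u' s du) => t; by case: u'D.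
exists (fun s => u' (s + h) - u' s); last exact: ih.
move=> s; apply: is_deriveB; rewrite -[u' _]mulr1.
apply: (@is_derive1_comp _ u (fun s => s + h)).
by rewrite -[X in is_derive _ _ _ X]addr0; apply: is_deriveD.
Qed.

(** A difference of order [k + 1] is a difference of order [k] of a first
    difference, and a first difference loses one derivative and gains a factor
    [h]. *)
Lemma dsmooth_ndiff k B u h s : dsmooth k (fun=> B) u ->
  `|ndiff k h u s| <= `|h| ^+ k * B.
Proof.
elim: k B u => [|k ih] B u uk.
  rewrite /ndiff big_ord1 subnn !expr0 bin0 !mul1r mul0r addr0.
  exact: dsmooth_bound uk.
rewrite ndiffS (le_trans (ih _ _ (dsmooth_shiftB h uk)))//.
by rewrite exprSr mulrA.
Qed.

End dominated_smoothness.

(** * Sums of signed bumps *)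

Lemma fdiff_bound (R : realType) (d r : nat) (v : 'rV[R]_d) (u : 'rV[R]_d -> R) B x :
  (forall y, `|u y| <= B) -> `|fdiff r v u x| <= 2 ^+ r * B.
Proof.
move=> uB; rewrite /fdiff (le_trans (ler_norm_sum _ _ _))//.
rewrite (@le_trans _ _ (\sum_(j < r.+1) 'C(r, j)%:R * B))//.
  apply: ler_sum => j _; rewrite !normrM normrX normrN1 expr1n mul1r normr_nat.
  by rewrite ler_wpM2l.
rewrite -mulr_suml -natr_sum -natrX ler_wpM2r//.
  exact: le_trans (uB x).
rewrite ler_nat -[X in (_ <= X ^ _)%N]/(1 + 1)%N.
rewrite expnDn leq_eqVlt; apply/orP; left; apply/eqP/eq_bigr => j _.
by rewrite !exp1n !muln1.
Qed.

Lemma fdiffB (R : realType) (d r : nat) (v : 'rV[R]_d) (f g : 'rV[R]_d -> R) x :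
  fdiff r v (fun y => f y - g y) x = fdiff r v f x - fdiff r v g x.
Proof. by rewrite /fdiff -sumrB; apply: eq_bigr => j _; rewrite mulrBr. Qed.

Lemma fdiff_sum (R : realType) (d r : nat) (v : 'rV[R]_d) (K : nat)
    (a : nat -> R) (g : nat -> 'rV[R]_d -> R) x :
  fdiff r v (fun y => \sum_(k < K) a k * g k y) x =
  \sum_(k < K) a k * fdiff r v (g k) x.
Proof.
rewrite /fdiff; under eq_bigr do rewrite mulr_sumr.
rewrite exchange_big; apply: eq_bigr => k _; rewrite mulr_sumr.
by apply: eq_bigr => j _; rewrite mulrCA.
Qed.

Section bumps.
Context (R : realType).

Lemma cut_power_le0 m (s : R) : s <= 0 -> cut_power m.+1 s = 0.
Proof. by rewrite /cut_power; case: ltgtP => // ->; rewrite expr0n. Qed.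

Lemma cut_power_ge0 m (s : R) : 0 <= s -> cut_power m s = s ^+ m.
Proof. by rewrite /cut_power ltNge => ->. Qed.

Lemma is_derive_cut_power m (s : R) :
  is_derive s 1 (cut_power m.+2) (m.+2%:R * cut_power m.+1 s).
Proof.
have [s0|s0|->] := ltgtP s 0.
- rewrite cut_power_le0 ?ltW// mulr0.
  apply: (@near_eq_is_derive _ _ _ (cst (0 : R))).
  by near=> t; rewrite cut_power_le0// ltW//; near: t; exact: lt_nbhsl.
- rewrite cut_power_ge0 ?ltW//.
  apply: (@near_eq_is_derive _ _ _ (fun t : R => t ^+ m.+2)).
    by near=> t; rewrite cut_power_ge0// ltW//; near: t; exact: lt_nbhsr.
  by rewrite -[X in is_derive _ _ _ X]mulr1; exact: is_derive_exp.
- rewrite cut_power_le0// mulr0.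
  have cv : h^-1 *: (cut_power m.+2 (h *: 1 + 0) - cut_power m.+2 0)
      @[h --> (0 : R)^'] --> (0 : R).
    rewrite (cut_power_le0 (m.+1) (lexx 0)).
    apply/cvgr0Pnorm_le => e e0.
    near=> h; rewrite /GRing.scale/= mulr1 addr0 subr0.
    have h0 : h != 0 by near: h; exact: nbhs_dnbhs_neq.
    have h1 : `|h| < Num.min 1 e.
      by near: h; apply: dnbhs0_lt; rewrite lt_min ltr01.
    move: h1; rewrite lt_min => /andP[/ltW h1 he].
    have [hn|hp] := leP h 0; first by rewrite cut_power_le0// mulr0 normr0 ltW.
    rewrite (cut_power_ge0 _ (ltW hp)) exprS mulKf// normrX exprS.
    by rewrite (le_trans _ (ltW he))// ler_piMr// exprn_ile1.
  apply: DeriveDef; last exact: (cvg_lim _ cv).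
  by apply/cvg_ex; exists 0.
Unshelve. all: by end_near. Qed.

Lemma dsmooth_cut_power k m n : (k < m)%N -> (m <= n)%N ->
  dsmooth k (fun s : R => n%:R ^+ k * ((0 < s)%R%:R * (1 + `|s|) ^+ n)) (cut_power m).
Proof.
have bnd m' k' (s : R) : (0 < m')%N -> (m' <= n)%N ->
    `|cut_power m' s| <= n%:R ^+ k' * ((0 < s)%R%:R * (1 + `|s|) ^+ n).
  move=> m0 mn; have [s0|s0] := leP s 0.
    by rewrite -(prednK m0) cut_power_le0// normr0 mul0r mulr0.
  rewrite (cut_power_ge0 _ (ltW s0)) mul1r normrX.
  rewrite (@le_trans _ _ ((1 + `|s|) ^+ n))//; last first.
    by rewrite ler_peMl ?exprn_ege1 ?ler1n ?(leq_trans m0)// exprn_ge0// addr_ge0.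
  rewrite (@le_trans _ _ ((1 + `|s|) ^+ m'))//.
    by rewrite lerXn2r ?nnegrE ?addr_ge0// lerDr.
  by rewrite ler_weXn2l// lerDl.
elim: k m => [|k ih] m km mn; first by split=> // s; exact: bnd.
split=> [s|]; first by apply: bnd => //; exact: leq_trans km.
case: m km mn => [|[|m]]// km mn.
exists (fun s => m.+2%:R * cut_power m.+1 s).
  by move=> s; exact: is_derive_cut_power.
apply: (dsmooth_le _ (dsmoothZ m.+2%:R (ih m.+1 km (ltnW mn)))) => s.
by rewrite exprS -mulrA normr_nat ler_wpM2r ?ler_nat//.
Qed.

(** A bump on the unit interval, with [m - 1] continuous derivatives. *)
Definition profile m (t : R) := cut_power m t * cut_power m (1 - t).

Lemma profile_out m t : ~~ (0 < t < 1) -> profile m.+1 t = 0.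
Proof.
rewrite negb_and -!leNgt /profile => /orP[t0|t1].
  by rewrite cut_power_le0// mul0r.
by rewrite [X in _ * X]cut_power_le0 ?mulr0// subr_le0.
Qed.

Lemma profile_ge m t : 4^-1 <= t <= 1 - 4^-1 -> (4^-1 * 4^-1) ^+ m <= profile m t.
Proof.
move=> /andP[t1 t2]; rewrite /profile !cut_power_ge0; [|lra|lra].
rewrite -exprMn lerXn2r// ?nnegrE; [lra|nra|].
apply: ler_pM; lra.
Qed.

Lemma dsmooth_profile k : exists2 C : R, 0 <= C &
  dsmooth k (fun s => C * (0 < s < 1)%R%:R) (profile k.+1).
Proof.
have h1 := dsmooth_cut_power (ltnSn k) (leqnn k.+1).
have h2 : dsmooth k
   (fun s : R => k.+1%:R ^+ k * ((0 < 1 - s)%R%:R * (1 + `|1 - s|) ^+ k.+1))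
   (fun s => cut_power k.+1 (1 - s)).
  have := dsmooth_affine 1 (_ : `|-1 : R| <= 1) h1.
  under eq_fun do rewrite mulN1r addrC.
  under [X in dsmooth _ _ X]eq_fun do rewrite mulN1r addrC.
  by apply; rewrite normrN1.
exists (2 ^+ k * ((k.+1%:R ^+ k * 2 ^+ k.+1) * (k.+1%:R ^+ k * 2 ^+ k.+1))).
  by rewrite !mulr_ge0// ?exprn_ge0.
apply: dsmooth_le (dsmoothM h1 h2) => s.
rewrite -mulrA ler_wpM2l ?exprn_ge0// subr_gt0.
have [s0|] := ltP 0 s; last by rewrite /= !(mul0r, mulr0).
have [s1|] := ltP s 1; last by rewrite /= !(mul0r, mulr0).
rewrite /= mulr1 !mul1r.
have h (x : R) : 0 <= x -> x <= 1 ->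
    k.+1%:R ^+ k * (1 + `|x|) ^+ k.+1 <= k.+1%:R ^+ k * 2 ^+ k.+1.
  move=> x0 x1; rewrite ler_wpM2l ?exprn_ge0// lerXn2r ?nnegrE ?addr_ge0// ger0_norm//.
  lra.
have p (x : R) : 0 <= k.+1%:R ^+ k * (1 + `|x|) ^+ k.+1.
  by rewrite mulr_ge0 ?exprn_ge0// addr_ge0.
by rewrite ler_pM//; apply: h; lra.
Qed.

Section multidimensional.
Variable d : nat.

Definition bump_sum (m M : nat) (L : R) (eps : {ffun {ffun 'I_d -> 'I_M} -> bool})
    (x : 'rV[R]_d) : R :=
  \sum_z (-1) ^+ (~~ eps z) * \prod_l profile m (L * x ord0 l - (z l)%:R).

(** In a cell, the bumps of all the other cells vanish. *)
Lemma bump_sum_node m M L (eps : {ffun {ffun 'I_d -> 'I_M} -> bool}) (t : 'rV[R]_d) z :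
  L != 0 -> (forall l, 4^-1 <= L * t ord0 l <= 1 - 4^-1) ->
  bump_sum m.+1 L eps (grid_point L t z) =
  (-1) ^+ (~~ eps z) * \prod_l profile m.+1 (L * t ord0 l).
Proof.
move=> L0 tL; rewrite /bump_sum (bigD1 z)//= [X in _ + X]big1 ?addr0.
  congr (_ * _); apply: eq_bigr => l _; congr profile.
  by rewrite mxE mulrDr mulrCA divff// mulr1 addrK.
move=> z' z'z; have [l zl] : exists l, z' l != z l.
  apply/existsP; apply: contraNT z'z => /existsPn h; apply/eqP/ffunP => l.
  by have := h l; rewrite negbK => /eqP.
rewrite (bigD1 l)//= profile_out ?mul0r ?mulr0//.
rewrite mxE mulrDr mulrCA divff// mulr1.
have := tL l; move: (L * t ord0 l) => y /andP[y1 y2].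
apply/negP => /andP[h1 h2]; move: zl; rewrite -val_eqE neq_ltn => /orP[|] zl.
- have : (z' l).+1%:R <= (z l)%:R :> R by rewrite ler_nat.
  by rewrite -natr1; lra.
- have : (z l).+1%:R <= (z' l)%:R :> R by rewrite ler_nat.
  by rewrite -natr1; lra.
Qed.

Lemma cells_disjoint M (y : 'I_d -> R) :
  \sum_(z : {ffun 'I_d -> 'I_M}) \prod_l (0 < y l - (z l)%:R < 1)%R%:R <= 1 :> R.
Proof.
rewrite -(bigA_distr_bigA (fun l (z : 'I_M) => (0 < y l - z%:R < 1)%R%:R : R)).
apply: prodr_ile1 => l _; rewrite sumr_ge0//=.
have [[z zP]|nz] := pselect (exists z : 'I_M, 0 < y l - z%:R < 1); last first.
  by rewrite big1 ?ler01// => z _;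
    case: (boolP (0 < y l - z%:R < 1)) => // zP; case: nz; exists z.
rewrite (bigD1 z)//= zP big1 ?addr0// => z' z'z.
case: (boolP (0 < y l - z'%:R < 1)) => // zP'; exfalso.
move: z'z; rewrite -val_eqE neq_ltn => /orP[|] zl.
- have : z'.+1%:R <= z%:R :> R by rewrite ler_nat.
  by rewrite -natr1; lra.
- have : z.+1%:R <= z'%:R :> R by rewrite ler_nat.
  by rewrite -natr1; lra.
Qed.

(** Along a line of speed at most [1 / L] in each coordinate, the bump of
    a cell and its first [r] derivatives are dominated by a multiple of the indicator function
    of that cell.  The cells are disjoint, so the bound for the sum is the
    bound for one bump, whatever the signs and the mesh. *)
Lemma dsmooth_bump r : exists2 B : R, 0 <= B & forall M (L : R)
  (eps : {ffun {ffun 'I_d -> 'I_M} -> bool}) (x v : 'rV[R]_d),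
  (forall l, `|L * v ord0 l| <= 1) ->
  dsmooth r (fun=> B) (fun s => bump_sum r.+1 L eps (x + s *: v)).
Proof.
have [C C0 hprofile] := dsmooth_profile r.
exists ((2 ^+ r * C) ^+ d); first by rewrite exprn_ge0// mulr_ge0// exprn_ge0.
move=> M L eps x v vL.
pose y s l := L * (x + s *: v) ord0 l.
have hl l (z : 'I_M) : dsmooth r (fun s => C * (0 < y s l - z%:R < 1)%R%:R)
    (fun s => profile r.+1 (y s l - z%:R)).
  have yE s : y s l - z%:R = L * v ord0 l * s + (L * x ord0 l - z%:R).
    by rewrite /y !mxE; ring.
  under eq_fun do rewrite yE.
  under [X in dsmooth _ _ X]eq_fun do rewrite yE.
  exact: (dsmooth_affine _ (vL l) hprofile).
have hz (z : {ffun 'I_d -> 'I_M}) :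
    dsmooth r (fun s => (2 ^+ r * C) ^+ d * \prod_l (0 < y s l - (z l)%:R < 1)%R%:R)
    (fun s => (-1) ^+ (~~ eps z) * \prod_l profile r.+1 (y s l - (z l)%:R)).
  apply: (dsmooth_le _ (dsmoothZ _ (dsmooth_prod _ (fun l => hl l (z l))))) => s.
  rewrite normrX normrN1 expr1n mul1r big_split/=.
  by rewrite prodr_const card_ord big_split/= prodr_const card_ord exprMn mulrA.
apply: (dsmooth_le _ (dsmooth_sum _ hz)) => s.
rewrite -mulr_sumr ler_piMr ?exprn_ge0 ?mulr_ge0 ?exprn_ge0//.
exact: cells_disjoint.
Qed.

(** For a small step the difference is taken along the line with direction [v],
    parametrized with the speed allowed by [dsmooth_bump]; the parameter step is
    then [L * delta]. *)
Lemma bump_sum_smooth r : exists2 B : R, 0 <= B & forall M (L : R)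
  (eps : {ffun {ffun 'I_d -> 'I_M} -> bool}) (x : 'rV[R]_d), 0 < L ->
  `|bump_sum r.+1 L eps x| <= B /\
  forall (v : 'rV[R]_d) (delta : R), 0 < delta -> (forall l, `|v ord0 l| <= delta) ->
    `|fdiff r v (bump_sum r.+1 L eps) x| <= B * Num.min 1 ((L * delta) ^+ r).
Proof.
have [B B0 hB] := dsmooth_bump r.
exists (2 ^+ r * B); first by rewrite mulr_ge0 ?exprn_ge0.
have r2 : 1 <= 2 ^+ r :> R by rewrite exprn_ege1// ler1n.
move=> M L eps x L0.
have bnd x' : `|bump_sum r.+1 L eps x'| <= B.
  have := @dsmooth_bound _ _ _ _ 0 (hB M L eps x' 0 _).
  by rewrite scaler0 addr0; apply => l; rewrite mxE mulr0 normr0.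
split; first by rewrite (le_trans (bnd x))// ler_peMl.
move=> v delta delta0 vd.
have Ld : 0 < L * delta by exact: mulr_gt0.
rewrite minEle; case: ifPn => _.
  by rewrite mulr1; exact: fdiff_bound.
pose V := (L * delta)^-1 *: v.
have := @dsmooth_ndiff _ r B _ (L * delta) 0 (hB M L eps x V _).
rewrite (_ : ndiff _ _ _ _ = fdiff r v (bump_sum r.+1 L eps) x); last first.
  rewrite /ndiff /fdiff; apply: eq_bigr => j _; congr (_ * bump_sum _ _ _ (_ + _)).
  by rewrite /V scalerA add0r mulfK// gt_eqF.
rewrite (gtr0_norm Ld) => h; apply: (le_trans (h _)) => [l|].
  rewrite mxE (_ : L * _ = v ord0 l / delta); last first.
    by field; rewrite !gt_eqF.
  rewrite normrM [X in _ * X]gtr0_norm ?invr_gt0// ler_pdivrMr// mul1r.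
  exact: vd.
rewrite [leRHS]mulrC; apply: ler_wpM2l; last by rewrite ler_peMl.
by rewrite exprn_ge0// ltW.
Qed.

End multidimensional.
End bumps.

(** * Translation invariance of Lebesgue measure *)

Section translation_invariance.
Context (R : realType).

Lemma measurable_rV_shift n (a : 'rV[R]_n) :
  measurable_fun [set: 'rV[R]_n] (fun x : 'rV[R]_n => x + a).
Proof.
apply/measurable_fun_rVP => i; under eq_fun do rewrite mxE.
apply: measurable_funD => //; exact: measurable_coord.
Qed.

Lemma lebesgue_measure_shift (a : R) (A : set (measurableTypeR R)) :
  measurable A ->
  lebesgue_measure ((fun x : measurableTypeR R => (x + a : measurableTypeR R)) @^-1` A) =
  lebesgue_measure A.
Proof.
move=> mA.
have mf : measurable_fun [set: measurableTypeR R]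
   (fun x : measurableTypeR R => (x + a : measurableTypeR R)).
  by apply: measurable_funD.
pose mf' := isMeasurableFun.Build _ _ _ _ _ mf.
pose F : {mfun _ >-> _} :=
  HB.pack (fun x : measurableTypeR R => (x + a : measurableTypeR R)) mf'.
apply/esym; apply: (lebesgue_measure_unique (mu := pushforward lebesgue_measure F)) => //.
move=> _ [[x y]] _ <-; rewrite /pushforward /=.
rewrite [X in _ = lebesgue_measure X](_ : _ = `](x - a), (y - a)]%classic); last first.
  by apply/seteqP; split=> z /=; rewrite !in_itv/= ltrBlDr lerBrDr.
rewrite !lebesgue_measure_itv/= !lte_fin ltrD2r; case: ifPn => // _.
by rewrite -!EFinB opprB addrA subrK.
Qed.

(** By uniqueness of product measures, one coordinate at a time. *)
Lemma lebesgue_rV_shift n (a : 'rV[R]_n) (A : set 'rV[R]_n) : measurable A ->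
  lebesgue_rV R n ((fun x => x + a) @^-1` A) = lebesgue_rV R n A.
Proof.
elim: n a A => [|n ih] a A mA.
  by rewrite (_ : _ @^-1` A = A)//; apply/seteqP; split=> x /=; rewrite (thinmx0 a) addr0.
rewrite /= /lebesgue_rV_succ /pushforward.
set mA' := @rV_cons R n @^-1` A.
have mmA' : measurable mA'.
  by rewrite -[X in measurable X]setTI; exact: measurable_rV_cons.
pose a0 := a ord0 ord0; pose a' : 'rV[R]_n := \row_i a ord0 (lift ord0 i).
pose S (q : measurableTypeR R * 'rV[R]_n) : measurableTypeR R * 'rV[R]_n :=
  (q.1 + a0, q.2 + a').
have mS : measurable_fun setT S.
  apply: measurable_fun_pair.
    by apply: measurable_funD => //; exact: measurable_fst.
  exact: (measurableT_comp (measurable_rV_shift a') measurable_snd).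
pose mS' := isMeasurableFun.Build _ _ _ _ _ mS.
pose F : {mfun _ >-> _} := HB.pack S mS'.
rewrite (_ : _ @^-1` (_ @^-1` A) = S @^-1` mA'); last first.
  apply/seteqP; split=> q /=; rewrite /mA'/= (_ : rV_cons q + a = rV_cons (S q))//;
    apply/rowP => i; rewrite !mxE; case: (unliftP ord0 i) => [j ->|->];
    by rewrite ?liftK ?unlift_none//= mxE// mxE.
rewrite [RHS](product_measure_unique
  (m' := pushforward (lebesgue_measure \x lebesgue_rV R n)%E F))//.
move=> B1 B2 mB1 mB2; rewrite /pushforward.
transitivity ((lebesgue_measure \x lebesgue_rV R n)%E
   (((fun x : measurableTypeR R => (x + a0 : measurableTypeR R)) @^-1` B1) `*`
   ((fun x => x + a') @^-1` B2))) => //.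
rewrite product_measure1E.
- by congr (_ * _)%E; [exact: lebesgue_measure_shift|exact: ih].
- by rewrite -[X in measurable X]setTI; apply: measurable_funD.
- by rewrite -[X in measurable X]setTI; exact: measurable_rV_shift.
Qed.

Lemma integral_rV_shift n (a : 'rV[R]_n) (Q : set 'rV[R]_n) (f : 'rV[R]_n -> \bar R) :
  measurable Q -> measurable_fun setT f -> (forall x, 0 <= f x)%E ->
  (\int[lebesgue_rV R n]_(x in [set x | Q (x - a)%R]) f x =
   \int[lebesgue_rV R n]_(x in Q) f (x + a)%R)%E.
Proof.
move=> mQ mf f0.
have mQa : measurable [set x | Q (x - a)].
  by rewrite -[X in measurable X]setTI; exact: (measurable_rV_shift (- a)).
pose mf' := isMeasurableFun.Build _ _ _ _ _ (measurable_rV_shift a).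
pose F : {mfun _ >-> _} := HB.pack (fun x : 'rV[R]_n => x + a) mf'.
transitivity (\int[pushforward (lebesgue_rV R n) F]_(x in [set x | Q (x - a)%R]) f x)%E.
  apply: eq_measure_integral => A mA _ /=.
  by rewrite /pushforward lebesgue_rV_shift.
rewrite ge0_integral_pushforward//.
- rewrite (_ : _ @^-1` _ = Q)//; apply/seteqP; split=> x /=; by rewrite addrK.
- exact: measurable_funTS.
Qed.
End translation_invariance.

(** * Bounds for L^p norms on the unit ball *)

Section norm_bounds.
Context (R : realType) (d : nat).
Local Notation mu := (lebesgue_rV R d).
Local Notation ball1 := (@unit_ball R d).

(** Read off the definition of the integral as a supremum over simple
    functions; this covers integrands that may fail to be measurable, such as
    differences on the domains [shift_dom]. *)
Lemma ge0_le_integralT (f g : 'rV[R]_d -> \bar R) :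
  (forall x, 0 <= f x)%E -> (forall x, f x <= g x)%E ->
  (\int[mu]_x f x <= \int[mu]_x g x)%E.
Proof.
move=> f0 fg; have g0 x : (0 <= g x)%E by exact: le_trans (fg x).
rewrite !ge0_integralTE//; apply: ereal_sup_le => _ [h hf <-].
by exists h => // x; exact: le_trans (fg x).
Qed.

Lemma measurable_dotp (w : 'rV[R]_d) : measurable_fun setT (dotp w).
Proof.
rewrite /dotp; apply: measurable_sum => i; apply: measurable_funM => //.
exact: measurable_coord.
Qed.

Lemma measurable_unit_ball : measurable ball1.
Proof.
have m2 : measurable_fun setT (fun x : 'rV[R]_d => dotp x x).
  rewrite /dotp; apply: measurable_sum => i.
  by apply: measurable_funM; exact: measurable_coord.
rewrite (_ : ball1 = (fun x : 'rV[R]_d => dotp x x) @^-1` [set y | y < 1]).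
  rewrite -[X in measurable X]setTI; apply: m2 => //.
  by rewrite -set_itvNyo.
apply/seteqP; split=> x; rewrite /unit_ball /enorm /= => h.
  by move: h; rewrite -{1}sqrtr1 ltr_sqrt.
by rewrite -sqrtr1 ltr_sqrt.
Qed.

Lemma dotpxx_ge_coord (x : 'rV[R]_d) l : x ord0 l ^+ 2 <= dotp x x.
Proof.
rewrite /dotp (bigD1 l)//= -expr2 lerDl sumr_ge0// => i _.
by rewrite -expr2 sqr_ge0.
Qed.

Lemma coord_le_enorm (x : 'rV[R]_d) l : `|x ord0 l| <= enorm x.
Proof. by rewrite /enorm -sqrtr_sqr ler_wsqrtr// dotpxx_ge_coord. Qed.

Lemma measurable_box (A : 'I_d -> set (measurableTypeR R)) :
  (forall i, measurable (A i)) ->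
  measurable [set x : 'rV[R]_d | forall i, A i (x ord0 i)].
Proof.
move=> mA; rewrite (_ : [set x : 'rV[R]_d | forall i, A i (x ord0 i)] =
    \big[setI/setT]_(i < d) ((fun x : 'rV[R]_d => x ord0 i) @^-1` A i)).
  apply: bigsetI_measurable => i _; rewrite -[X in measurable X]setTI.
  exact: (measurable_coord i measurableT (mA i)).
by rewrite -bigcap_seq; apply/seteqP; split=> x /= h i; [move=> _; exact: h|
     apply: h => /=; rewrite mem_index_enum].
Qed.

Lemma unit_ball_measure : (mu ball1 <= (2 ^+ d)%:E)%E.
Proof.
pose A (i : 'I_d) : set (measurableTypeR R) := `[(-1 : R), 1]%classic.
have mA i : measurable (A i) by exact: measurable_itv.
have -> : (2 ^+ d)%:E = mu [set x : 'rV[R]_d | forall i, A i (x ord0 i)].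
  rewrite lebesgue_rV_box//.
  rewrite (eq_bigr (fun=> 2%:E)); last first.
    move=> i _; rewrite lebesgue_measure_itv/= lte_fin.
    have -> : (-1 : R) < 1 by lra.
    by rewrite opprK.
  by rewrite prodEFin prodr_const card_ord.
apply: le_measure; rewrite ?inE.
- exact: measurable_unit_ball.
- exact: measurable_box.
- move=> x xb i; rewrite /A/= in_itv/= -ler_norml.
  by apply: (le_trans (coord_le_enorm x i)); exact: ltW.
Qed.

Lemma powR_restrict (D : set 'rV[R]_d) (p : R) (f : 'rV[R]_d -> R) x : 0 < p ->
  (`|(EFin \o f \_ D) x| `^ p = (fun y => (`|f y| `^ p)%:E) \_ D x)%E.
Proof.
move=> p0; rewrite /= /patch; case: (x \in D) => //=.
by rewrite normr0 powR0// gt_eqF.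
Qed.

Lemma Lnorm_on_le (D : set 'rV[R]_d) (p c : R) (f : 'rV[R]_d -> R) :
  D `<=` ball1 -> 1 <= p -> 0 <= c -> (forall x, `|f x| <= c) ->
  (Lnorm_on D p f <= (c * (2 ^+ d) `^ p^-1)%:E)%E.
Proof.
move=> Db p1 c0 fc; have p0 : 0 < p by rewrite (lt_le_trans _ p1).
rewrite /Lnorm_on unlock.
have -> : (c * (2 ^+ d) `^ p^-1)%:E = (((c `^ p) * 2 ^+ d)%:E `^ p^-1)%E.
  by rewrite poweR_EFin powRM ?exprn_ge0 ?powR_ge0// -powRrM mulfV ?gt_eqF// powRr1.
apply: gt0_ler_poweR.
- by rewrite invr_ge0 ltW.
- by rewrite in_itv/= leey andbT integral_ge0// => x _; exact: poweR_ge0.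
- by rewrite in_itv/= leey andbT lee_fin mulr_ge0 ?powR_ge0 ?exprn_ge0.
apply: (@le_trans _ _ (\int[mu]_(x in ball1) (c `^ p)%:E)%E); last first.
  rewrite (integral_cst _ measurable_unit_ball) EFinM.
  by apply: lee_wpmul2l; [rewrite lee_fin powR_ge0|exact: unit_ball_measure].
rewrite [leRHS]integral_mkcond; apply: ge0_le_integralT => x.
  exact: poweR_ge0.
rewrite powR_restrict// !patchE.
have [xD|xD] := boolP (x \in D).
  have -> : x \in ball1 by move: xD; rewrite !inE; exact: Db.
  by rewrite lee_fin; apply: ge0_ler_powR; rewrite ?nnegrE// ltW.
by case: (x \in ball1); rewrite lee_fin// powR_ge0.
Qed.

Lemma Lnorm_on_lt_integral (D : set 'rV[R]_d) (p c : R) (f : 'rV[R]_d -> R) :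
  1 <= p -> 0 <= c -> (Lnorm_on D p f < c%:E)%E ->
  (\int[mu]_(x in D) ((`|f x| `^ p)%:E) <= (c `^ p)%:E)%E.
Proof.
move=> p1 c0 /ltW fc; have p0 : 0 < p by rewrite (lt_le_trans _ p1).
rewrite (_ : (\int[mu]_(x in D) _)%E = (Lnorm_on D p f `^ p)%E).
  rewrite -poweR_EFin; apply: gt0_ler_poweR => //.
  - exact: ltW.
  - by rewrite in_itv/= leey andbT; exact: Lnorm_ge0.
  - by rewrite in_itv/= leey andbT lee_fin.
rewrite /Lnorm_on.
rewrite poweR_Lnorm; last exact: lt0r_neq0.
rewrite (integral_mkcond D).
by apply: eq_integral => x _; rewrite powR_restrict.
Qed.

End norm_bounds.

(** * The lower bound for one scale *)

Section averaging.
Context (R : realType) (d : nat).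
Local Notation mu := (lebesgue_rV R d).

(** The translates of [Q] are disjoint and lie in [D], so the integral of
    [F e] over [D] is at least the integral over [Q] of the sum of its values at
    the nodes [t + a z]; then sums and integrals are interchanged. *)
Lemma averaging (E Z : finType) (F : E -> 'rV[R]_d -> R) (a : Z -> 'rV[R]_d)
    (Q D : set 'rV[R]_d) (kappa : R) :
  measurable Q -> measurable D ->
  (forall e, measurable_fun setT (F e)) -> (forall e x, 0 <= F e x) ->
  (forall z x, Q (x - a z) -> D x) ->
  (forall z z' x, Q (x - a z) -> Q (x - a z') -> z = z') ->
  0 <= kappa -> (forall t, Q t -> kappa <= \sum_e \sum_z F e (t + a z)) ->
  (kappa%:E * mu Q <= \sum_e \int[mu]_(x in D) (F e x)%:E)%E.
Proof.
move=> mQ mD mF F0 QD Qdisj k0 kF.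
pose Fa e z (t : 'rV[R]_d) : \bar R := (F e (t + a z))%:E.
pose Qa z : set 'rV[R]_d := [set x | Q (x - a z)].
have mQa z : measurable (Qa z).
  by rewrite -[X in measurable X]setTI; exact: (measurable_rV_shift (- a z)).
have mFE e : measurable_fun setT (fun x => (F e x)%:E).
  exact/measurable_EFinP.
have F0E e x : (0 <= (F e x)%:E)%E by rewrite lee_fin.
have mFa e z : measurable_fun setT (Fa e z).
  apply/measurable_EFinP.
  exact: (measurableT_comp (mF e) (measurable_rV_shift (a z))).
apply: (@le_trans _ _ (\sum_e \sum_z \int[mu]_(t in Q) Fa e z t)%E); last first.
  apply: lee_sum => e _.
  under eq_bigr => z _ do rewrite -(integral_rV_shift (a z) mQ (mFE e) (F0E e)).
  rewrite -(@ge0_integral_bigsetU _ _ _ mu Z Qa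
     (fun x => (F e x)%:E)) ?index_enum_uniq//.
  - apply: ge0_subset_integral => //.
    + exact: bigsetU_measurable.
    + exact: measurable_funTS.
    + move=> x; rewrite -bigcup_seq => -[z _]; exact: QD.
  - by apply/trivIsetP => z z' _ _ /eqP zz'; rewrite -subset0 => x [/= h1 h2];
      apply: zz'; exact: Qdisj h1 h2.
  - exact: measurable_funTS.
rewrite (_ : (\sum_e _)%E =
  (\int[mu]_(t in Q) \sum_e \sum_z Fa e z t)%E); last first.
  rewrite ge0_integral_sum//.
  - apply: eq_bigr => e _; rewrite ge0_integral_sum// => [z|z x _].
      exact: measurable_funTS.
    by rewrite lee_fin.
  - move=> e; apply: emeasurable_sum => z; exact: measurable_funTS.
  - by move=> e t _; apply: sume_ge0 => z _; rewrite lee_fin.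
rewrite -(integral_cst mu mQ); apply: ge0_le_integral => //.
- apply: emeasurable_sum => e; apply: emeasurable_sum => z; exact: measurable_funTS.
- move=> t /kF; rewrite -lee_fin => /le_trans; apply.
  by rewrite /Fa -sumEFin; apply: lee_sum => e _; rewrite -sumEFin.
Qed.

End averaging.

Section lower_bound.
Context (R : realType) (d : nat).
Local Notation mu := (lebesgue_rV R d).
Local Notation ball1 := (@unit_ball R d).

Lemma measurable_cut_power k : measurable_fun setT (@cut_power R k).
Proof.
rewrite /cut_power; apply: measurable_fun_if => //.
exact: measurable_fun_ltr.
Qed.

Lemma measurable_logistic : measurable_fun setT (@logistic R).
Proof.
apply: continuous_measurable_fun => x; rewrite /logistic.
apply: cvgM; first exact: cvg_cst.
apply: cvgV; first by rewrite gt_eqF// addr_gt0// expR_gt0.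
apply: cvgD; first exact: cvg_cst.
apply: continuous_comp; last exact: continuous_expR.
by apply: cvgN; exact: cvg_id.
Qed.

Lemma measurable_ridge_sum sigma n (h : 'rV[R]_d -> R) :
  measurable_fun setT sigma -> ridge_sums sigma n h -> measurable_fun setT h.
Proof.
move=> ms [a [c [w ->]]]; apply: measurable_sum => j; apply: measurable_funM => //.
apply: measurableT_comp => //; apply: measurable_funD => //.
exact: measurable_dotp.
Qed.

Lemma measurable_bump_sum r M (L : R) (eps : {ffun {ffun 'I_d -> 'I_M} -> bool}) :
  measurable_fun setT (bump_sum r L eps).
Proof.
apply: measurable_sum => z; apply: measurable_funM => //.
apply: measurable_prod => l _.
have mprofile : measurable_fun setT (@profile R r).
  apply: measurable_funM; first exact: measurable_cut_power.
  apply: (measurableT_comp (@measurable_cut_power r)).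
  exact: measurable_funB.
apply: (measurableT_comp mprofile); apply: measurable_funB => //.
by apply: measurable_funM => //; exact: measurable_coord.
Qed.

(** A lower bound for a bump on the middle half of its cell in every
    coordinate. *)
Definition plateau r : R := ((4^-1 * 4^-1) ^+ r) ^+ d.

Lemma plateau_gt0 r : 0 < plateau r.
Proof. by rewrite !exprn_gt0. Qed.

(** With this scale the [M ^ d] cells lie in a cube of side [1 / (2 d)], which
    is contained in the unit ball. *)
Definition grid_scale M : R := (2 * d * M)%:R.

(** If the sign of the bump is not that of [h - G], then [h - G] is on the
    other side of zero from the bump, and the distance between the two is at
    least the height of the bump; the perturbation [e] takes at most
    half of it. *)
Lemma bump_mismatch r M (eps : {ffun {ffun 'I_d -> 'I_M} -> bool}) (t : 'rV[R]_d) z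
    (G h e a : R) :
  grid_scale M != 0 -> (forall l, 4^-1 <= grid_scale M * t ord0 l <= 1 - 4^-1) ->
  0 < a -> `|e| <= a * plateau r.+1 / 2 -> eps z != (G < h) ->
  a * plateau r.+1 / 2 <=
  `|G + a * bump_sum r.+1 (grid_scale M) eps (grid_point (grid_scale M) t z) + e - h|.
Proof.
move=> L0 tL a0 ea; rewrite bump_sum_node//.
have : plateau r.+1 <= \prod_l profile r.+1 (grid_scale M * t ord0 l).
  rewrite /plateau -[X in _ ^+ X]card_ord -prodr_const.
  by apply: ler_prod => l _; rewrite exprn_ge0//= profile_ge.
move: (\prod_l _) => b bP.
have ab : a * plateau r.+1 <= a * b by rewrite ler_wpM2l// ltW.
move: ea; rewrite ler_norml => /andP[e1 e2].
case: (eps z); case: ltP => //= Gh _; rewrite ?expr0 ?expr1.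
  by rewrite (le_trans _ (ler_norm _))//; lra.
by rewrite -normrN (le_trans _ (ler_norm _))//; lra.
Qed.

Lemma powR_half_lt (p x : R) : 0 < p -> 0 < x -> (x / 2) `^ p < x `^ p.
Proof. by move=> p0 x0; apply: gt0_ltr_powR => //; rewrite ?nnegrE; lra. Qed.

(** If the lemma fails, every [eps] has a network [h] and a perturbation [e] that
    violate the estimate.  For each position [t] of the grid, assign to [eps] the
    sign pattern at the nodes of its own [h] relative to [G].  By [few_centers_far],
    the number of mismatches, averaged over [eps], is at least [K] for
    each [t], and [averaging] shows that the integrals over the ball are
    too large on average over [eps]. *)
Lemma bump_lower_bound (sigma : R -> R) (C r : nat) (p : R) : (0 < d)%N -> 1 <= p ->
  measurable_fun setT sigma -> few_patterns d sigma C ->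
  exists2 c : R, 0 < c & forall n M K : nat, (0 < n)%N -> (0 < M)%N ->
    ((C * n * M) ^ (C * n) <= 4 ^ K)%N -> (8 * K <= M ^ d)%N ->
    (M ^ d <= 16 * K)%N ->
    forall (G : 'rV[R]_d -> R) (a : R), measurable_fun setT G -> 0 < a ->
    exists eps : {ffun {ffun 'I_d -> 'I_M} -> bool},
    forall h e : 'rV[R]_d -> R, ridge_sums sigma n h -> measurable_fun setT e ->
      (forall x, `|e x| <= a * plateau r.+1 / 2) ->
      ((c * a)%:E <= Lnorm_on ball1 p
        (fun x => (G x + a * bump_sum r.+1 (grid_scale M) eps x + e x - h x)%R))%E.
Proof.
move=> d0 p1 ms fewC; have p0 : 0 < p by rewrite (lt_le_trans _ p1).
set beta := plateau r.+1; have beta0 : 0 < beta by exact: plateau_gt0.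
(* A lower bound for [K * mu Q], where [mu Q = (2 L) ^- d] and
   [L = 2 d M], by the hypothesis [M ^ d <= 16 * K]. *)
pose kap : R := ((4 * d) ^ d * 16)%:R^-1.
have kap0 : 0 < kap by rewrite invr_gt0 ltr0n muln_gt0 expn_gt0 muln_gt0 d0.
exists (kap `^ p^-1 * (beta / 4)); first by rewrite mulr_gt0 ?powR_gt0 ?divr_gt0.
set c := _ * _; move=> n M K n0 M0 CK KM MK G a mG a0.
set L := grid_scale M.
have L0 : 0 < L by rewrite ltr0n !muln_gt0 d0.
pose Z := {ffun 'I_d -> 'I_M}.
apply: contrapT => /forallNP noeps.
have {noeps} : forall eps : {ffun Z -> bool},
  exists he : ('rV[R]_d -> R) * ('rV[R]_d -> R),
  [/\ ridge_sums sigma n he.1, measurable_fun setT he.2,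
    (forall x, `|he.2 x| <= a * beta / 2) &
    (Lnorm_on ball1 p
        (fun x => G x + a * bump_sum r.+1 L eps x + he.2 x - he.1 x)%R < (c * a)%:E)%E].
  move=> eps; apply: contrapT => /forallNP nohe; apply: (noeps eps) => h e hh me eb.
  by rewrite leNgt; apply/negP => lt; apply: (nohe (h, e)).
move=> /choice[he heP].
pose D eps x := G x + a * bump_sum r.+1 L eps x + (he eps).2 x - (he eps).1 x.
pose F eps x := `|D eps x| `^ p.
pose A (l : 'I_d) : set (measurableTypeR R) := `[4^-1 / L, (1 - 4^-1) / L]%classic.
have mA l : measurable (A l) by exact: measurable_itv.
(* The positions [t] for which all the nodes are in the middle halves of
   their cells. *)
pose Q := [set t : 'rV[R]_d | forall l, A l (t ord0 l)].
have QP t : Q t <-> forall l, 4^-1 <= L * t ord0 l <= 1 - 4^-1.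
  split=> h l; have := h l; rewrite /A/= in_itv/=;
  by rewrite ler_pdivrMr// ler_pdivlMr// [t _ _ * _]mulrC.
have muQ : mu Q = (((2 * L)^-1) ^+ d)%:E.
  rewrite /Q lebesgue_rV_box// (eq_bigr (fun=> ((2 * L)^-1)%:E)).
    by rewrite prodEFin prodr_const card_ord.
  move=> l _; rewrite /A lebesgue_measure_itv/= lte_fin ifT; last first.
    by rewrite ltr_pM2r ?invr_gt0//; lra.
  rewrite -EFinB; congr EFin; field.
  by rewrite !pnatr_eq0 -!lt0n M0 d0.
pose av (z : Z) : 'rV[R]_d := \row_l ((z l)%:R / L).
have gridE t z : grid_point L t z = t + av z.
  by apply/rowP => l; rewrite !mxE.
have LavE (x : 'rV[R]_d) z l : L * (x - av z) ord0 l = L * x ord0 l - (z l)%:R.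
  by rewrite !mxE mulrBr mulrCA divff ?gt_eqF// mulr1.
pose tau := a * beta / 2.
have tau0 : 0 < tau by rewrite divr_gt0// mulr_gt0.
have mF eps : measurable_fun setT (F eps).
  have [hh me _ _] := heP eps.
  apply: (measurableT_comp (@measurable_powR R p)).
  apply: (measurableT_comp (@normr_measurable R setT)).
  apply: measurable_funB; last exact: measurable_ridge_sum hh.
  apply: measurable_funD => //; apply: measurable_funD => //.
  by apply: measurable_funM => //; exact: measurable_bump_sum.
have QD z x : Q (x - av z) -> ball1 x.
  move=> /QP xQ; rewrite /unit_ball/= /enorm -sqrtr1 ltr_sqrt//.
  have xl l : `|x ord0 l| <= (2 * d%:R)^-1.
    have := xQ l; rewrite LavE => /andP[x1 x2].
    have zM : (z l)%:R + 1 <= M%:R :> R by rewrite natr1 ler_nat.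
    have z0 : 0 <= (z l)%:R :> R by [].
    have Lx0 : 0 <= L * x ord0 l by lra.
    rewrite ger0_norm; last by rewrite -(pmulr_rge0 _ L0).
    have d0' : 0 < d%:R :> R by rewrite ltr0n.
    have M0' : 0 < M%:R :> R by rewrite ltr0n.
    rewrite -(ler_pM2l L0) (_ : L * (2 * d%:R)^-1 = M%:R); first by lra.
    by rewrite /L /grid_scale !natrM; field; rewrite gt_eqF.
  rewrite (@le_lt_trans _ _ (\sum_(l < d) (2 * d%:R)^-1 ^+ 2))//.
    apply: ler_sum => l _; rewrite -expr2 -real_normK ?num_real//.
    by rewrite lerXn2r// ?nnegrE// invr_ge0 mulr_ge0.
  have d1' : 1 <= d%:R :> R by rewrite ler1n.
  rewrite sumr_const card_ord -[_ *+ d]mulr_natl.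
  have -> : d%:R * (2 * d%:R)^-1 ^+ 2 = (4 * d%:R)^-1 :> R.
    by field; rewrite pnatr_eq0 -lt0n.
  by rewrite invf_lt1; lra.
have Qdisj z z' x : Q (x - av z) -> Q (x - av z') -> z = z'.
  move=> /QP h1 /QP h2; apply/ffunP => l; apply/val_inj/eqP.
  have := h1 l; have := h2 l; rewrite !LavE.
  move=> /andP[a1 a2] /andP[b1 b2]; apply: contraT.
  rewrite neq_ltn => /orP[|] zl.
  - have : (z l).+1%:R <= (z' l)%:R :> R by rewrite ler_nat.
    by rewrite -natr1; lra.
  - have : (z' l).+1%:R <= (z l)%:R :> R by rewrite ler_nat.
    by rewrite -natr1; lra.
have kF t : Q t -> (K * 2 ^ #|{: Z}|)%:R * tau `^ p <= \sum_eps \sum_z F eps (t + av z).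
  move=> /QP tQ.
  pose b (z : Z) := G (grid_point L t z).
  pose pi (eps : {ffun Z -> bool}) : {ffun Z -> bool} :=
    [ffun z : Z => b z < (he eps).1 (grid_point L t z)].
  have far : (K * 2 ^ #|{: Z}|)%:R <= (\sum_s hamming s (pi s))%:R :> R.
    rewrite ler_nat.
    apply: (few_centers_far (S := ridge_patterns sigma n (@grid_point R d M L t) b)).
    - move=> eps; rewrite inE; apply/asboolP; have [hh _ _ _] := heP eps.
      by exists (he eps).1 => // z; rewrite ffunE.
    - by apply: leq_trans CK; exact: fewC.
    - by rewrite card_ffun !card_ord.
  apply: (@le_trans _ _ ((\sum_s hamming s (pi s))%:R * tau `^ p)).
    by rewrite ler_wpM2r// powR_ge0.
  rewrite natr_sum mulr_suml; apply: ler_sum => eps _.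
  rewrite /hamming natr_sum mulr_suml; apply: ler_sum => z _.
  have [_|neq] := eqVneq (eps z) (pi eps z).
    by rewrite mul0r powR_ge0.
  rewrite mul1r -gridE; apply: ge0_ler_powR; rewrite ?nnegrE//; [exact: ltW|exact: ltW|].
  have [_ _ eb _] := heP eps.
  apply: bump_mismatch => //; first by rewrite gt_eqF.
  by move: neq; rewrite ffunE.
have F0 eps x : 0 <= F eps x by exact: powR_ge0.
have kap'0 : 0 <= (K * 2 ^ #|{: Z}|)%:R * tau `^ p by rewrite mulr_ge0// powR_ge0.
have := averaging (measurable_box mA) (@measurable_unit_ball R d) mF F0 QD Qdisj kap'0 kF.
rewrite muQ -EFinM; apply/negP; rewrite -ltNge.
have Fc eps : (\int[mu]_(x in ball1) (F eps x)%:E <= ((c * a) `^ p)%:E)%E.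
  have [_ _ _ lt] := heP eps.
  apply: Lnorm_on_lt_integral lt => //.
  by rewrite mulr_ge0 ?(ltW a0)// mulr_ge0 ?powR_ge0// divr_ge0// ltW.
apply: (@le_lt_trans _ _ (\sum_(eps : {ffun Z -> bool}) ((c * a) `^ p)%:E)%E).
  by apply: lee_sum => eps _.
rewrite sumEFin lte_fin sumr_const card_ffun card_bool.
have cpE : (c * a) `^ p = kap * (tau / 2) `^ p.
  rewrite /c (_ : _ * a = kap `^ p^-1 * (tau / 2)); last by rewrite /tau; field.
  rewrite powRM ?powR_ge0//; last by rewrite divr_ge0// ltW.
  by rewrite -powRrM mulVf ?gt_eqF// powRr1// ltW.
have kapK : kap <= K%:R * (2 * L)^-1 ^+ d.
  rewrite exprVn ler_pdivlMr ?exprn_gt0 ?mulr_gt0//.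
  rewrite mulrC ler_pdivrMr ?ltr0n ?muln_gt0 ?expn_gt0 ?muln_gt0 ?d0//.
  rewrite /L /grid_scale -natrM -natrX -natrM ler_nat.
  rewrite (_ : 2 * (2 * d * M) = 4 * d * M)%N; last by ring.
  by rewrite expnMn; nia.
have tau2 := powR_half_lt p0 tau0.
rewrite natrM cpE -[_ *+ (2 ^ _)]mulr_natl.
have P0 : 0 < (2 ^ #|{: Z}|)%:R :> R by rewrite ltr0n expn_gt0.
have t0 := powR_ge0 (tau / 2) p.
apply: (@lt_le_trans _ _ ((2 ^ #|{: Z}|)%:R * (kap * tau `^ p))).
  by rewrite ltr_pM2l// ltr_pM2l.
have mulrACM (k q s u : R) : k * q * s * u = q * ((k * u) * s) by ring.
rewrite mulrACM.
by rewrite ler_pM2l// ler_wpM2r// powR_ge0.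
Qed.

End lower_bound.

(** * The choice of the scales *)

(** With [n = 2 ^ m] units, [M] is the least integer with
    [2 ^ B * n * (m + 1) <= M ^ d], so that [M ^ d] exceeds this number by a factor
    of at most [2 ^ d].  The logarithm of [(C n M) ^ (C n)] is at most
    [C n (C + d + B + 3 m)], which is linear in [B], whereas [M ^ d] is
    exponential in [B]: a large [B] works for all [m]. *)
Lemma grid_size (C d : nat) : (0 < d)%N -> exists B, forall m, exists M K,
  [/\ (0 < M)%N, ((C * 2 ^ m * M) ^ (C * 2 ^ m) <= 4 ^ K)%N,
      (8 * K <= M ^ d <= 16 * K)%N,
      (m.+1 <= M ^ d)%N & (M ^ d <= 2 ^ (d + B) * (2 ^ m * m.+1))%N].
Proof.
move=> d0; pose b := (C + d + 10)%N; exists (b + b + 3)%N => m.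
set B := (b + b + 3)%N; pose T := (2 ^ B * (2 ^ m * m.+1))%N.
have b2 : (b < 2 ^ b)%N by exact: ltn_expl.
have b3 : (3 * b <= 2 ^ b)%N.
  rewrite /b (_ : C + d + 10 = 4 + (C + d + 6))%N; last by lia.
  rewrite expnD; have : (C + d + 6 < 2 ^ (C + d + 6))%N by exact: ltn_expl.
  by lia.
have m2 : (m.+1 <= 2 ^ m)%N by exact: ltn_expl.
have T8 : (8 <= T)%N.
  rewrite /T /B expnD -mulnA mulnCA leq_pmulr// muln_gt0 expn_gt0/=.
  by rewrite muln_gt0 expn_gt0.
have exM : exists M, (T <= M ^ d)%N.
  exists T; rewrite -{1}[T]expn1 leq_pexp2l//; exact: leq_trans T8.
pose M := ex_minn exM.
have [TM Mmin] : (T <= M ^ d)%N /\ forall k, (T <= k ^ d)%N -> (M <= k)%N.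
  by rewrite /M; case: ex_minnP.
have M1 : (1 < M)%N.
  case: (M) TM => [|[|//]]; first by rewrite exp0n// leqn0 => /eqP T0; rewrite T0 in T8.
  by rewrite exp1n => T1; have := leq_trans T8 T1.
have MT : (M ^ d <= 2 ^ d * T)%N.
  apply: (@leq_trans ((2 * M.-1) ^ d)); first by apply: leq_expn; lia.
  rewrite expnMn leq_mul2l; apply/orP; right.
  rewrite leqNgt; apply/negP => /ltnW /Mmin; lia.
exists M, (M ^ d %/ 8)%N.
have Kd := divn_eq (M ^ d) 8; have Kr : (M ^ d %% 8 < 8)%N by exact: ltn_pmod.
set K := (M ^ d %/ 8)%N in Kd *.
have MMd : (M <= M ^ d)%N by rewrite -{1}[M]expn1 leq_pexp2l// ltnW.
have MTB : (M ^ d <= 2 ^ (d + B) * (2 ^ m * m.+1))%N by rewrite expnD -mulnA.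
split=> //.
- exact: ltnW.
- have CnM : (C * 2 ^ m * M <= 2 ^ (C + d + B + 3 * m))%N.
    rewrite (_ : C + d + B + 3 * m = C + m + (d + B + m + m))%N; last by lia.
    rewrite expnD leq_mul//.
      by rewrite expnD leq_mul2r (ltnW (ltn_expl C _))// orbT.
    rewrite (leq_trans MMd)// (leq_trans MTB)// !expnD -!mulnA !leq_mul2l.
    by rewrite m2 !orbT.
  rewrite (leq_trans (leq_expn _ CnM))// -expnM (_ : 4 = 2 ^ 2)%N// -expnM leq_exp2l//.
  apply: (@leq_trans (2 ^ (b + b) * (2 ^ m * m.+1))).
    apply: (@leq_trans (C * (C + d + B + 3) * (2 ^ m * m.+1))).
      apply: (@leq_trans ((C + d + B + 3) * m.+1 * (C * 2 ^ m))).
        by rewrite leq_mul2r; apply/orP; right; nia.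
      by rewrite leq_eqVlt; apply/orP; left; apply/eqP; ring.
    rewrite leq_mul2r; apply/orP; right; rewrite expnD leq_mul//.
      by rewrite (leq_trans _ (ltnW b2))// /b; lia.
    by rewrite (leq_trans _ b3)// /B /b; lia.
  have : (2 ^ (b + b) * (2 ^ m * m.+1) * 8 = T)%N.
    by rewrite /T /B [in RHS]expnD; ring.
  lia.
- by apply/andP; split; lia.
- apply: leq_trans TM; rewrite /T mulnA leq_pmull// muln_gt0 !expn_gt0//.
Qed.

Section modulus.
Context (R : realType) (w : R -> R).
Hypothesis hw : abstract_modulus w.

Lemma amod_mulrn n x : 0 < x -> w (n.+1%:R * x) <= n.+1%:R * w x.
Proof.
move=> x0; elim: n => [|n ih]; first by rewrite !mul1r.
rewrite -natr1 !mulrDl !mul1r (le_trans (amod_subadditive hw _ _))//.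
  by rewrite mulr_gt0.
by rewrite lerD2r.
Qed.

(** Up to a factor two, subadditivity makes [w t / t] nonincreasing. *)
Lemma amod_ratio s t : 0 < s -> s <= t -> w t / t <= 2 * (w s / s).
Proof.
move=> s0 st; have t0 : 0 < t by exact: lt_le_trans st.
have ts1 : 1 <= t / s by rewrite ler_pdivlMr// mul1r.
have /andP[N1 N2] := truncn_itv (le_trans ler01 ts1).
set N := Num.truncn _ in N1 N2.
have wt : w t <= N.+1%:R * w s.
  apply: le_trans (amod_mulrn N s0); apply: (amod_nondecreasing hw); first exact: ltW.
  by rewrite -ler_pdivrMr// ltW.
rewrite ler_pdivrMr// (le_trans wt)//.
rewrite (_ : 2 * (w s / s) * t = (2 * (t / s)) * w s); last by ring.
rewrite ler_wpM2r ?(amod_ge0 hw) ?(ltW s0)//.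
by rewrite -natr1; lra.
Qed.

Lemma sum_geometric_tail (a : nat -> R) J K :
  (forall k, 0 <= a k) -> (forall k, 2 * a k.+1 <= a k) ->
  \sum_(J <= k < K) a k <= 2 * a J.
Proof.
move=> a0 a2; have [KJ|/ltnW JK] := leqP K J.
  by rewrite big_geq// mulr_ge0.
rewrite -(subnKC JK); elim: (K - J)%N => [|n ih].
  by rewrite addn0 big_geq// mulr_ge0.
suff : \sum_(J <= k < J + n) a k <= 2 * a J - 2 * a (J + n)%N.
  move=> h; rewrite addnS big_nat_recr ?leq_addr//=.
  have := a0 (J + n)%N; lra.
elim: n {ih} => [|n ih]; first by rewrite addn0 big_geq// subrr.
rewrite addnS big_nat_recr ?leq_addr//=.
have := a2 (J + n)%N; lra.
Qed.

(** The terms with [theta k < s] form a geometrically decreasing sum, whose first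
    term is at most [w s].  The other terms are [s * (w (theta k) / theta k)];
    these increase geometrically, and the last of them is at most [2 * w s] by
    [amod_ratio]. *)
Lemma sum_modulus_min (theta : nat -> R) s K : 0 < s ->
  (forall k, 0 < theta k) -> (forall k, theta k.+1 <= theta k) ->
  (forall k, 2 * w (theta k.+1) <= w (theta k)) ->
  (forall k, 2 * (w (theta k) / theta k) <= w (theta k.+1) / theta k.+1) ->
  \sum_(k < K) w (theta k) * Num.min 1 (s / theta k) <= 6 * w s.
Proof.
move=> s0 th0 thS aS bS.
have w0 k : 0 < w (theta k) by exact: amod_gt0.
have ws0 : 0 < w s by exact: amod_gt0.
pose b k := w (theta k) / theta k.
have b0 k : 0 < b k by rewrite divr_gt0.
have thmono i j : (i <= j)%N -> theta j <= theta i.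
  by move=> ij; apply: (@homo_leq _ theta (fun x y => y <= x)) => // y x z h1 h2;
    exact: le_trans h2 h1.
have small : \sum_(k < K) (if theta k < s then w (theta k) else 0) <= 2 * w s.
  suff : \sum_(k < K) (if theta k < s then w (theta k) else 0) = 0 \/
    \sum_(k < K) (if theta k < s then w (theta k) else 0) <= 2 * w s - 2 * w (theta K).
    by move=> [->|]; [rewrite mulr_ge0// ltW|have := w0 K; lra].
  elim: K => [|K ih]; first by left; rewrite big_ord0.
  rewrite big_ord_recr/=; case: ifPn => [ths|_]; last first.
    rewrite addr0; case: ih => [->|h]; [by left|right].
    by have := aS K; have := w0 K.+1; lra.
  right; have wKs : w (theta K) <= w s by apply: (amod_nondecreasing hw); exact: ltW.
  by have := aS K; case: ih => [->|h]; lra.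
have large J : \sum_(k < J) (if theta k < s then 0 else b k) <= 4 * (w s / s).
  have sumb n : \sum_(k < n) b k <= b n.
    elim: n => [|n ih]; first by rewrite big_ord0 ltW.
    by rewrite big_ord_recr/=; have := bS n; rewrite -/(b _) -/(b _); lra.
  have ws'0 : 0 < w s / s by rewrite divr_gt0.
  elim: J => [|J ih]; first by rewrite big_ord0; lra.
  rewrite big_ord_recr/=; case: ltP => sth; first by rewrite addr0.
  apply: (@le_trans _ _ (\sum_(k < J) b k + b J)).
    rewrite lerD2r; apply: ler_sum => k _; case: ifPn => // _; exact: ltW.
  have := sumb J; have := amod_ratio s0 sth; rewrite -/(b J); lra.
apply: (@le_trans _ _ (\sum_(k < K) (if theta k < s then w (theta k) else 0) +
    s * \sum_(k < K) (if theta k < s then 0 else b k))).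
  rewrite mulr_sumr -big_split/=; apply: ler_sum => k _.
  case: ifPn => ths.
    by rewrite mulr0 addr0 ler_piMr ?(ltW (w0 k))// ge_min lexx.
  by rewrite add0r /b mulrCA ler_wpM2l ?(ltW (w0 k))// ge_min lexx orbT.
have : s * \sum_(k < K) (if theta k < s then 0 else b k) <= s * (4 * (w s / s)).
  by rewrite ler_pM2l.
rewrite (_ : s * (4 * (w s / s)) = 4 * w s) => [h|]; first by move: small; lra.
by field; rewrite gt_eqF.
Qed.

Lemma amod_cvg0 : w x @[x --> 0^'+] --> 0.
Proof.
have /continuous_within_itvcyP[_] := amod_continuous hw.
by rewrite (amod0 hw).
Qed.

End modulus.

(** Both conditions on the next scale hold for all small values of [theta]: the
    first since [w] tends to zero, the second since [w delta / delta] tends to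
    infinity. *)
Lemma sparse_step (R : realType) (w : R -> R) (theta : nat -> R) (eta : R) :
  abstract_modulus w -> w delta / delta @[delta --> 0^'+] --> +oo ->
  (forall m, 0 < theta m) -> theta @ \oo --> (0 : R) -> 0 < eta ->
  exists step, forall m, [/\ (m < step m)%N, theta (step m) <= theta m,
    w (theta (step m)) <= eta * w (theta m) &
    2 * (w (theta m) / theta m) <= w (theta (step m)) / theta (step m)].
Proof.
move=> hw hlim th0 thc eta0.
suff /choice[step stepP] : forall m, exists m', [/\ (m < m')%N, theta m' <= theta m,
    w (theta m') <= eta * w (theta m) &
    2 * (w (theta m) / theta m) <= w (theta m') / theta m'].
  by exists step.
move=> m; have w0 : 0 < w (theta m) by exact: amod_gt0.
have near1 : \forall x \near 0^'+, w x <= eta * w (theta m).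
  have : \forall x \near 0^'+, w x < eta * w (theta m).
    by apply: (cvgr_lt (0 : R) (amod_cvg0 hw)); rewrite mulr_gt0.
  by apply: filterS => x; exact: ltW.
have near2 : \forall x \near 0^'+, 2 * (w (theta m) / theta m) <= w x / x.
  by move/cvgryPge : hlim; exact.
have near3 : \forall x \near 0^'+, x <= theta m.
  by apply: nbhs_right_le.
have cvgr : theta n @[n --> \oo] --> 0^'+.
  move=> P [e /= e0 eP]; 
  have h : \forall n \near \oo, theta n < e := cvgr_lt _ thc _ e0.
  case: h => N _ h; exists N => // n /h/= thn; apply: eP => //=.
  by rewrite sub0r normrN gtr0_norm.
have near0 : \forall n \near \oo, (m < n)%N by exists m.+1.
have := filterI near0 (cvgr _ (filterI near1 (filterI near2 near3))).
by move=> [N _ /(_ N (leqnn N))[/= ? [? [? ?]]]]; exists N.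
Qed.

(** * The lacunary series *)

(** The remainder after [K] terms is at most twice the bound of the [K]-th
    term, since the bounds are halved at each step. *)
Lemma dominated_series_limit (R : realType) (T : Type) (u : nat -> T -> R)
    (a : nat -> R) (B : R) :
  (forall k x, `|u k x| <= B * a k) -> 0 <= B -> (forall k, 0 <= a k) ->
  (forall k, 2 * a k.+1 <= a k) ->
  exists f : T -> R,
    (forall x, \sum_(k < K) u k x @[K --> \oo] --> f x) /\
    forall K x, `|f x - \sum_(k < K) u k x| <= B * (2 * a K).
Proof.
move=> uB B0 a0 a2.
have bnd x J K : (J <= K)%N ->
    `|\sum_(k < K) u k x - \sum_(k < J) u k x| <= B * (2 * a J).
  move=> JK; rewrite -(big_mkord xpredT (fun k => u k x)).
  rewrite -(big_mkord xpredT (fun k => u k x)).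
  rewrite (big_cat_nat (n := J))//= addrAC subrr add0r.
  rewrite (le_trans (ler_norm_sum _ _ _))//.
  apply: (@le_trans _ _ (\sum_(J <= k < K) B * a k)).
    by apply: ler_sum => k _.
  by rewrite -mulr_sumr ler_wpM2l// sum_geometric_tail.
have cv x : cvgn (fun K => \sum_(k < K) u k x).
  rewrite (_ : (fun K => _) = series (fun k => u k x)); last first.
    by apply/funext => K; rewrite /series/= big_mkord.
  apply: normed_cvg; apply: nondecreasing_is_cvgn.
    apply/nondecreasing_seqP => n; rewrite -subr_ge0 seriesSB.
    exact: normr_ge0.
  exists (B * (2 * a 0%N)) => _ [n _ <-]; rewrite /series/=.
  apply: (@le_trans _ _ (\sum_(0 <= k < n) B * a k)).
    by apply: ler_sum => k _.
  by rewrite -mulr_sumr ler_wpM2l// sum_geometric_tail.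
exists (fun x => limn (fun K => \sum_(k < K) u k x)); split; first exact: cv.
move=> K x; set l := limn _.
have cvl : `|\sum_(k < J) u k x - \sum_(k < K) u k x| @[J --> \oo] -->
    `|l - \sum_(k < K) u k x|.
  by apply: cvg_norm; apply: cvgB; [exact: cv|exact: cvg_cst].
rewrite -(cvg_lim _ cvl)//; apply: limr_le; first by apply/cvg_ex; eexists; exact: cvl.
by exists K => // J /= KJ; exact: bnd.
Qed.

Lemma limn_esup_gt0 (R : realType) (u : nat -> \bar R) (c : R) (n_ : nat -> nat) :
  0 < c -> (forall k, (k <= n_ k)%N) -> (forall k, (c%:E <= u (n_ k))%E) ->
  (0 < limn_esup u)%E.
Proof.
move=> c0 n_ge uc; apply: (@lt_le_trans _ _ c%:E); first by rewrite lte_fin.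
rewrite limn_esup_lim; apply: lime_ge; first exact: is_cvg_esups.
apply: nearW => N; apply: (le_trans (uc N)).
by apply: ereal_sup_ubound; exists (n_ N) => //=.
Qed.

Lemma theta_cvg0 (R : realType) (d r : nat) (M : nat -> nat) : (0 < r)%N ->
  (forall m, (0 < M m)%N) -> (forall m, (m.+1 <= M m ^ d)%N) ->
  ((M m)%:R ^+ r)^-1 @[m --> \oo] --> (0 : R).
Proof.
move=> r0 M0 Mm; apply/cvgr0Pnorm_lt => e e0.
pose X := (Num.truncn e^-1).+1.
have e'0 : 0 <= e^-1 by rewrite invr_ge0 ltW.
have /andP[_ Xe] := truncn_itv e'0.
exists (X ^ d)%N => // m /= Xm.
have XM : (X <= M m)%N.
  rewrite leqNgt; apply/negP => /ltnW/(leq_expn d) h.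
  by have := leq_trans (Mm m) (leq_trans h Xm); rewrite ltnn.
have Mr : X%:R <= (M m)%:R ^+ r :> R.
  rewrite -natrX ler_nat (leq_trans XM)//.
  by rewrite -{1}[M m]expn1 leq_pexp2l.
rewrite normfV ger0_norm ?exprn_ge0// invf_plt ?posrE ?exprn_gt0 ?ltr0n//.
exact: lt_le_trans Xe Mr.
Qed.

Lemma log2_pow2 (R : realType) m : log2 (2 ^ m)%:R = m%:R :> R.
Proof.
by rewrite /log2 natrX lnXn// -[_ *+ m]mulr_natl mulfK// gt_eqF// ln_gt0// ltr1n.
Qed.

(** The choice of [M] makes [M ^ d] comparable with [n (1 + log2 n)] for
    [n = 2 ^ m], so the argument of the modulus in the theorem is at most a
    constant multiple of [M ^- r], and a constant factor comes out of [w] by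
    subadditivity. *)
Lemma amod_argument (R : realType) (w : R -> R) (d r B m M : nat) :
  abstract_modulus w -> (0 < d)%N -> (0 < M)%N ->
  (M ^ d <= 2 ^ (d + B) * (2 ^ m * m.+1))%N ->
  0 < w (1 / ((2 ^ m)%:R * (1 + log2 ((2 ^ m)%:R : R))) `^ (r%:R / d%:R)) <=
    (2 ^ ((d + B) * r))%:R * w ((M%:R ^+ r)^-1).
Proof.
move=> hw d0 M0 MB; rewrite log2_pow2 nat1r -natrM.
set X := (2 ^ m * m.+1)%N in MB *.
have X0 : 0 < X%:R :> R by rewrite ltr0n muln_gt0 expn_gt0.
have Xp : 0 < X%:R `^ (r%:R / d%:R) :> R by exact: powR_gt0.
have Mr : 0 < M%:R ^+ r :> R by rewrite exprn_gt0// ltr0n.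
have J0 : (0 < 2 ^ ((d + B) * r))%N by rewrite expn_gt0.
apply/andP; split; first by apply: amod_gt0 => //; rewrite div1r invr_gt0.
apply: (@le_trans _ _ (w ((2 ^ ((d + B) * r))%:R * (M%:R ^+ r)^-1))); last first.
  by rewrite -(prednK J0); apply: amod_mulrn => //; rewrite invr_gt0.
apply: amod_nondecreasing => //.
rewrite div1r ler_pdivlMr// ler_pdivrMl//.
have dn0 : d%:R != 0 :> R by rewrite pnatr_eq0 -lt0n.
have -> : M%:R ^+ r = (M ^ d)%:R `^ (r%:R / d%:R) :> R.
  rewrite natrX -[X in X `^ _]powR_mulrn// -powRrM -powR_mulrn//; congr (_ `^ _).
  by rewrite mulrCA mulfV// mulr1.
apply: (@le_trans _ _ ((2 ^ (d + B) * X)%:R `^ (r%:R / d%:R))).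
  by apply: ge0_ler_powR; rewrite ?nnegrE ?divr_ge0// ler_nat.
rewrite natrM powRM// mulrC ler_wpM2l ?powR_ge0//.
rewrite expnM [leRHS]natrX -powR_mulrn//; apply: ler_powR.
  by rewrite ler1n expn_gt0.
by rewrite ler_pdivrMr ?ltr0n// ler_peMr// ler1n.
Qed.

Lemma minr1_scale (R : realType) (D y : R) : 1 <= D ->
  Num.min 1 (D * y) <= D * Num.min 1 y.
Proof.
move=> D1; case: (leP 1 y) => _; last by rewrite ge_min lexx orbT.
by rewrite mulr1 ge_min D1.
Qed.

Theorem theorem3p4 (R : realType) (d r : nat) (p : R) (sigma w : R -> R)
  (hd : (0 < d)%N) (hr : (0 < r)%N) (hp : 1 <= p)
  (hsigma : sigma = @logistic R \/
            exists k : nat, (0 < k)%N /\ sigma = @cut_power R k)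
  (hw : abstract_modulus w)
  (hlim : w delta / delta @[delta --> 0^'+] --> +oo) :
  exists f : 'rV[R]_d -> R,
    [/\ Lfun_on (@unit_ball R d) p f,
        bigO_right0 (fun delta => radial_modulus r f delta p (@unit_ball R d))
                    (fun delta => w (delta ^+ r)) &
        not_littleo
          (fun n => best_approx (ridge_sums sigma n) f p (@unit_ball R d))
          (fun n => w (1 / (n%:R * (1 + log2 (n%:R : R))) `^ (r%:R / d%:R)))].
Proof.
have [ms [C fewC]] : measurable_fun setT sigma /\ exists C, few_patterns d sigma C.
  case: hsigma => [->|[[|k] [// _ ->]]].
    split; [exact: measurable_logistic|exact: logistic_few_patterns].
  split; [exact: measurable_cut_power|exact: cut_power_few_patterns].
have [c c0 lower] := bump_lower_bound r hd hp ms fewC.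
have [B B0 bumpP] := bump_sum_smooth R d r.
set pl := plateau R d r.+1 in lower.
have pl0 : 0 < pl by exact: plateau_gt0.
(* The ratio of consecutive coefficients: a series with ratio at most one half
   has a remainder of at most [2 * B * a k.+1], and the second bound makes
   this at most half the height of the bumps of level [k]. *)
pose eta := Num.min 2^-1 (pl / (4 * (B + 1))).
have B1 : 0 < 4 * (B + 1) by rewrite mulr_gt0// ltr_wpDl.
have eta0 : 0 < eta by rewrite lt_min invr_gt0 ltr0n divr_gt0.
have eta2 : eta <= 2^-1 by rewrite ge_min lexx.
have etaB : 4 * B * eta <= pl.
  rewrite (@le_trans _ _ (4 * (B + 1) * eta))//.
    by rewrite ler_wpM2r ?(ltW eta0)//; lra.
  by rewrite -ler_pdivlMl// mulrC ge_min lexx orbT.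
have [Bn gs] := grid_size C hd.
have /choice[MK MKP] : forall m, exists MK : nat * nat,
  [/\ (0 < MK.1)%N, ((C * 2 ^ m * MK.1) ^ (C * 2 ^ m) <= 4 ^ MK.2)%N,
      (8 * MK.2 <= MK.1 ^ d <= 16 * MK.2)%N,
      (m.+1 <= MK.1 ^ d)%N & (MK.1 ^ d <= 2 ^ (d + Bn) * (2 ^ m * m.+1))%N].
  by move=> m; have [M [K H]] := gs m; exists (M, K).
pose M m := (MK m).1.
have M0 m : (0 < M m)%N by have [] := MKP m.
have Mm m : (m.+1 <= M m ^ d)%N by have [] := MKP m.
pose theta m : R := ((M m)%:R ^+ r)^-1.
have th0 m : 0 < theta m by rewrite invr_gt0 exprn_gt0// ltr0n.
have thc : theta @ \oo --> (0 : R) by exact: theta_cvg0.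
have [step stepP] := sparse_step hw hlim th0 thc eta0.
pose m_ k := iter k step 0%N.
have m_ge k : (k <= m_ k)%N.
  elim: k => // k ih; apply: (leq_ltn_trans ih).
  by have [] := stepP (m_ k).
pose th k := theta (m_ k); pose a k := w (th k).
have a0 k : 0 < a k by apply: (amod_gt0 hw); exact: th0.
have age0 k : 0 <= a k by exact: ltW.
have aeta k : a k.+1 <= eta * a k by have [] := stepP (m_ k).
have a2 k : 2 * a k.+1 <= a k.
  have := aeta k; have : eta * a k <= 2^-1 * a k by rewrite ler_wpM2r.
  by move: (a k) (a k.+1) (eta * a k) => x y z; lra.
have thS k : th k.+1 <= th k by have [] := stepP (m_ k).
have bS k : 2 * (a k / th k) <= a k.+1 / th k.+1 by have [] := stepP (m_ k).
pose L k := grid_scale R d (M (m_ k)).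
have L0 k : 0 < L k by rewrite ltr0n !muln_gt0 hd M0.
(* What the level [k] bump sum [g] must satisfy relative to the preceding
   partial sum [G]. *)
pose P k (G g : 'rV[R]_d -> R) := [/\ measurable_fun setT g,
  (forall x, `|g x| <= B),
  (forall (x v : 'rV[R]_d) (delta : R), 0 < delta -> (forall l, `|v ord0 l| <= delta) ->
    `|fdiff r v g x| <= B * Num.min 1 ((L k * delta) ^+ r)) &
  (measurable_fun setT G -> forall h e : 'rV[R]_d -> R,
     ridge_sums sigma (2 ^ m_ k) h -> measurable_fun setT e ->
     (forall x, `|e x| <= a k * pl / 2) ->
     ((c * a k)%:E <= Lnorm_on (@unit_ball R d) p
        (fun x => (G x + a k * g x + e x - h x)%R))%E)].
have exP k (G : 'rV[R]_d -> R) (eps : {ffun {ffun 'I_d -> 'I_(M (m_ k))} -> bool}) :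
  (measurable_fun setT G -> forall h e : 'rV[R]_d -> R,
     ridge_sums sigma (2 ^ m_ k) h -> measurable_fun setT e ->
     (forall x, `|e x| <= a k * pl / 2) ->
     ((c * a k)%:E <= Lnorm_on (@unit_ball R d) p
        (fun x => (G x + a k * bump_sum r.+1 (L k) eps x + e x - h x)%R))%E) ->
   P k G (@bump_sum R d r.+1 (M (m_ k)) (L k) eps).
  move=> H; split => //; first exact: measurable_bump_sum.
    by move=> x; have [] := bumpP _ _ eps x (L0 k).
  by move=> x v delta; have [_] := bumpP _ _ eps x (L0 k); exact.
have /choice[b bP] : forall kG : nat * ('rV[R]_d -> R), exists g, P kG.1 kG.2 g.
  move=> [k G]/=.
  have [mG|nmG] := pselect (measurable_fun setT G).
    have [h1 h2 /andP[h3 h4] _ _] := MKP (m_ k).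
    have n0 : (0 < 2 ^ m_ k)%N by rewrite expn_gt0.
    have [eps epsP] := lower _ _ _ n0 h1 h2 h3 h4 G (a k) mG (a0 k).
    by eexists; apply: (exP k G eps) => _; exact: epsP.
  by eexists; apply: (exP k G [ffun=> true]) => /nmG.
pose G := nat_rect (fun=> 'rV[R]_d -> R) (fun=> 0)
  (fun k Gk x => Gk x + a k * b (k, Gk) x).
pose g k := b (k, G k).
have GS k x : G k.+1 x = G k x + a k * g k x by [].
have GE K : G K = (fun x => \sum_(k < K) a k * g k x).
  elim: K => [|K ih]; apply/funext => x; first by rewrite big_ord0.
  by rewrite GS ih big_ord_recr.
have gP k : P k (G k) (g k) by exact: (bP (k, G k)).
have mG k : measurable_fun setT (G k).
  elim: k => [|k ih]; first exact: measurable_cst.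
  by have [mg _ _ _] := gP k; apply: measurable_funD => //; exact: measurable_funM.
have uB k x : `|a k * g k x| <= B * a k.
  have [_ gB _ _] := gP k.
  by rewrite normrM (gtr0_norm (a0 k)) mulrC ler_wpM2r.
have [f [fcv ftail]] := dominated_series_limit uB B0 age0 a2.
have mf : measurable_fun setT f.
  apply: (measurable_fun_cvg (h := G)) => // x _.
  by under eq_fun do rewrite GE; exact: fcv.
have fG K x : `|f x - G K x| <= B * (2 * a K) by rewrite GE; exact: ftail.
exists f; split.
- have fB x : `|f x| <= B * (2 * a 0%N) by have := fG 0%N x; rewrite subr0.
  rewrite /Lfun_on inE; apply/andP; split; rewrite inE.
    apply: (measurable_restrictT f (@measurable_unit_ball R d)).1.
    exact: measurable_funTS.
  have c'0 : 0 <= B * (2 * a 0%N) by rewrite !mulr_ge0.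
  have sub : @unit_ball R d `<=` @unit_ball R d by [].
  exact: le_lt_trans (Lnorm_on_le sub hp c'0 fB) (ltry _).
- pose V : R := (2 ^+ d) `^ p^-1.
  pose A : R := B * (2 * d%:R) ^+ r * 6 + 2 ^+ r * (B * 2).
  have d1 : 1 <= 2 * d%:R :> R by rewrite -natrM ler1n muln_gt0.
  have A0 : 0 <= A by rewrite addr_ge0// !mulr_ge0 ?exprn_ge0.
  exists (A * V); near=> delta.
  have delta0 : 0 < delta by near: delta; exact: nbhs_right_gt.
  have s0 : 0 < delta ^+ r by rewrite exprn_gt0.
  have ws0 : 0 < w (delta ^+ r) by exact: amod_gt0.
  (* The remainder after the first [K] with [th K <= delta ^+ r] is O(a K), and
     [a K <= w (delta ^+ r)]. *)
  have [K thK] : exists K, th K <= delta ^+ r.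
    have [N _ thN] : \forall m \near \oo, theta m < delta ^+ r.
      exact: cvgr_lt thc _ s0.
    by exists N; apply: ltW; apply: thN; exact: m_ge.
  apply: ge_ereal_sup => _ [v /= vdelta <-].
  have vl l : `|v ord0 l| <= delta by apply: le_trans vdelta; exact: coord_le_enorm.
  have fdiffB_le x : `|fdiff r v f x| <= A * w (delta ^+ r).
    have -> : fdiff r v f x = fdiff r v (G K) x + fdiff r v (fun y => f y - G K y) x.
      by rewrite fdiffB addrC subrK.
    rewrite (le_trans (ler_normD _ _))// mulrDl lerD//; last first.
      rewrite (le_trans (fdiff_bound _ _ _ (fG K)))// -!mulrA.
      rewrite !ler_wpM2l ?exprn_ge0//.
      by apply: amod_nondecreasing => //; exact: (ltW (th0 _)).
    rewrite GE fdiff_sum (le_trans (ler_norm_sum _ _ _))// -mulrA.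
    apply: (@le_trans _ _ (\sum_(k < K) B * (2 * d%:R) ^+ r *
        (a k * Num.min 1 (delta ^+ r / th k)))).
      apply: ler_sum => k _; rewrite normrM (gtr0_norm (a0 k)) mulrCA.
      rewrite ler_wpM2l//; have [_ _ gd _] := gP k.
      apply: (le_trans (gd _ _ _ delta0 vl)); rewrite -mulrA ler_wpM2l//.
      have -> : (L k * delta) ^+ r = (2 * d%:R) ^+ r * (delta ^+ r / th k).
        by rewrite /L /grid_scale /th /theta invrK !natrM !exprMn; ring.
      by apply: minr1_scale; rewrite exprn_ege1.
    rewrite -mulr_sumr ler_wpM2l ?mulr_ge0 ?exprn_ge0//.
    exact: (@sum_modulus_min R w hw th (delta ^+ r) K s0 (fun k => th0 _) thS a2 bS).
  have Aw0 : 0 <= A * w (delta ^+ r) by rewrite mulr_ge0// ltW.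
  have sub : shift_dom (@unit_ball R d) (r%:R *: v) `<=` @unit_ball R d by move=> x [].
  apply: le_trans (Lnorm_on_le sub hp Aw0 fdiffB_le) _.
  by rewrite lee_fin mulrAC.
- pose J : R := (2 ^ ((d + Bn) * r))%:R.
  have J0 : 0 < J by rewrite ltr0n expn_gt0.
  apply: (@limn_esup_gt0 _ _ (c / J) (fun k => 2 ^ m_ k)%N); first exact: divr_gt0.
    by move=> k; apply: leq_trans (m_ge k) _; exact: ltnW (ltn_expl _ _).
  move=> k; have [_ _ _ _ MB] := MKP (m_ k).
  have /andP[arg0 argJ] := amod_argument r hw hd (M0 (m_ k)) MB.
  rewrite inver gt_eqF// lee_pdivlMr// -EFinM.
  apply: (@le_trans _ _ (c * a k)%:E).
    by rewrite lee_fin -mulrA ler_wpM2l ?(ltW c0)// ler_pdivrMl//.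
  apply: le_ereal_inf_tmp => _ [h hh <-].
  have [_ _ _ gH] := gP k.
  (* The terms after the [k]-th act as the perturbation in the lower bound. *)
  pose e x := f x - G k.+1 x.
  have me : measurable_fun setT e by exact: measurable_funB.
  have eB x : `|e x| <= a k * pl / 2.
    rewrite (le_trans (fG k.+1 x))//.
    have h1 : B * a k.+1 <= B * (eta * a k) by rewrite ler_wpM2l.
    have h2 : 4 * B * eta * a k <= pl * a k by rewrite ler_wpM2r.
    by move: h1 h2; rewrite !mulrA; lra.
  have := gH (mG k) h e hh me eB.
  rewrite (_ : (fun x => _) = f \- h)//; apply/funext => x /=.
  by rewrite /e GS addrC [RHS]addrC; congr (_ + _); rewrite addrC subrK.
Unshelve. all: by end_near.
Qed.
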